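(* Let $d\ge 1$, $\kappa\ge 1$, and let $(a(e);e\in\mathbb L^d)$ be i.i.d. random conductances on the edges of $\mathbb Z^d$ with $\kappa^{-1}\le a(e)\le\kappa$ almost surely. Let $\dot{\mathcal D}_N=(\dot{\mathcal D}_N^{ij})_{1\le i,j\le d}$ be the diffusion matrix of the $N$-periodized environment and let $\alpha>0$ be the Hölder regularity exponent (both described in the context). Put $$2\nu(d)=\max\{\alpha,\ d-4+\alpha\}.$$ Then there is a constant $C$, $0<C<\infty$, depending only on the dimension $d$ and on the ellipticity constant $\kappa$, such that for all $t>0$ and all $N\ge 1$, $$\max_{i,j}\mathbb P\big(|\dot{\mathcal D}_N^{ij}-\mathbb E\dot{\mathcal D}_N^{ij}|\ge t N^{-\nu(d)}\big)\le 4\exp(-Ct),$$ $$\max_{i,j}\mathrm{Var}(\dot{\mathcal D}_N^{ij})\le 8C^{-2}N^{-2\nu(d)}.$$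
   Context: $\mathbb L^d$ is the set of nearest-neighbour edges of $\mathbb Z^d$; $x\sim y$ means $|x-y|=1$ (Euclidean norm); $a(x,y)=a(y,x)$ is the conductance of the edge with endpoints $x\sim y$. $\mathbb P$ is the law of the conductances, with expectation $\mathbb E$ and variance $\mathrm{Var}$. $|\cdot|_\infty$ is the $\ell_\infty$-norm. For $N\ge1$, $Q_N=\{1,\dots,N\}^d$. Vectors are columns and $'$ denotes transpose. Periodized environment: $\dot a_N(x,y)=a(\dot x,\dot y)$ for $x\sim y$ in $\mathbb Z^d$, where $\dot x\sim\dot y$ is the pair of neighbours in $\{0,\dots,N\}^d$, at least one of which lies in $Q_N$, that is obtained from $(x,y)$ by a translation by an element of $N\mathbb Z^d$. Let $\dot a_N(x)=\sum_{y\sim x}\dot a_N(x,y)$, $\dot p_N(x,y)=\dot a_N(x,y)/\dot a_N(x)$, $\dot H_Nu(x)=u(x)-\sum_{y\sim x}\dot p_N(x,y)u(y)$, $\dot\pi_N(x)=\dot a_N(x)/\sum_{z\in Q_N}\dot a_N(z)$. Periodic corrector: with $g(x)=x$, $\dot\chi_N:\mathbb Z^d\to\mathbb R^d$ is the unique $N$-periodic function (in each coordinate direction) with $\sum_{x\in Q_N}\dot\chi_N(x)\dot a_N(x)=0$ and $\dot H_N\dot\chi_N=-\dot H_N g$ (operators act coordinatewise). Put $\dot v_N(x)=x+\dot\chi_N(x)$. Diffusion matrix: $\dot{\mathcal D}_N=\sum_{x\in Q_N}\dot\pi_N(x)\sum_{y\sim x}\dot p_N(x,y)\,(\dot v_N(y)-\dot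 v_N(x))(\dot v_N(y)-\dot v_N(x))'$. It is the covariance matrix of the Gaussian limit of $n^{-1/2}X_n$, where $(X_n)$ is the random walk with transition probabilities $\dot p_N$. Hölder exponent: $\alpha>0$ is an exponent depending only on $d$ and $\kappa$ for which, for some constant $C'=C'(d,\kappa)<\infty$, the following regularity estimate holds (such $\alpha$ exists, by a known result of Delmotte). For every deterministic family of conductances on $\mathbb L^d$ with values in $[\kappa^{-1},\kappa]$, every $N\ge1$, every $z\in\mathbb Z^d$ and every $u:\{x:|x-z|_\infty\le 2N+1\}\to\mathbb R$ satisfying $\sum_{y\sim x}a(x,y)(u(x)-u(y))=0$ for all $|x-z|_\infty\le 2N$, one has $|u(x)-u(y)|\le C'\left(\frac{|x-y|_\infty}{N}\right)^{\alpha}\max_{|w-z|_\infty\le 2N}|u(w)|$ for all $x,y$ with $|x-z|_\infty\le N$, $|y-z|_\infty\le N$. *)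

(* Defs.v *)
From HB Require Import structures.
From mathcomp Require Import all_boot all_order all_algebra.
From mathcomp Require Import all_classical all_reals all_analysis.
From mathcomp Require Import zify.

Set Implicit Arguments.
Unset Strict Implicit.
Unset Printing Implicit Defensive.

Import Order.TTheory GRing.Theory Num.Theory.
Import numFieldNormedType.Exports.

Local Open Scope classical_set_scope.
Local Open Scope ring_scope.

Section Lattice.
Variable d : nat.

Definition Zd := 'cV[int]_d.

Definition unitv (i : 'I_d) : Zd := delta_mx i 0.

Definition adj (x y : Zd) : bool := \sum_i (x i 0 - y i 0) ^+ 2 == 1.

Definition normoo (x : Zd) : nat := (\max_(i < d) absz (x i 0)%R)%N.

(* An unoriented edge {x, x + e_i} is encoded by its lower endpoint x and its
   direction i. *)
Definition edge : Type := (Zd * 'I_d)%type.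

Definition nbrs (x : Zd) : seq Zd :=
  [seq x + unitv i | i <- enum 'I_d] ++ [seq x - unitv i | i <- enum 'I_d].

(* Q_N = {1, ..., N}^d, as a duplicate-free list. *)
Definition QN (N : nat) : seq Zd :=
  [seq map_mx (fun k : 'I_N => (k.+1)%:Z) f | f <- enum {: 'cV['I_N]_d}].

(* The representative of the pair (x, y), modulo N Z^d, whose coordinatewise
   maximum lies in Q_N; see perpairP and perpair_uniq. *)
Definition pershift (N : nat) (x y : Zd) : Zd :=
  \col_i divz (Num.max (x i 0) (y i 0) - 1) N.
Definition perpair (N : nat) (x y : Zd) : Zd * Zd :=
  (x - pershift N x y *+ N, y - pershift N x y *+ N).

End Lattice.

Section LatticeFacts.
Variable d : nat.
Implicit Types (x y : Zd d) (N : nat).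

Lemma adjP x y :
  reflect (exists i, y = x + unitv i \/ y = x - unitv i) (adj x y).
Proof.
apply: (iffP eqP) => [h|[i hi]]; last first.
  rewrite (bigD1 i) //= big1 ?addr0; last first.
    move=> j ji; case: hi => ->; rewrite !mxE (negbTE ji) /= ?subr0 ?addr0 subrr
      expr0n //.
  by case: hi => ->; rewrite !mxE !eqxx /= expr2; lia.
have [i hi] : exists i, x i 0 - y i 0 != 0.
  apply/existsP; apply: contra_eqT h => /existsPn h0.
  by rewrite big1 // => i _; move: (h0 i); rewrite negbK => /eqP ->; rewrite expr0n.
have h1 : 0 < (x i 0 - y i 0) ^+ 2 by rewrite exprn_even_gt0.
move: h; rewrite (bigD1 i) //= => h.
have hs : \sum_(j | j != i) (x j 0 - y j 0) ^+ 2 >= 0.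
  by apply: sumr_ge0 => j _; rewrite sqr_ge0.
have h0 : \sum_(j | j != i) (x j 0 - y j 0) ^+ 2 = 0.
  by move: h h1 hs; move: (_ ^+ 2) (\sum_(_ | _) _) => A B; lia.
have hj j : j != i -> y j 0 = x j 0.
  move=> ji; move/eqP: h0; rewrite psumr_eq0; last by move=> *; rewrite sqr_ge0.
  move/allP/(_ j (mem_index_enum _)); rewrite ji /= sqrf_eq0 subr_eq0.
  by move/eqP.
have e1 : (x i 0 - y i 0) ^+ 2 = 1 by rewrite -h h0 addr0.
exists i; have [e|e] : y i 0 = x i 0 + 1 \/ y i 0 = x i 0 - 1.
  by move/eqP: e1; rewrite sqrf_eq1 => /orP[] /eqP; lia.
- left; apply/matrixP => j k; rewrite ord1 !mxE.
  by have [->|ji] := eqVneq j i; rewrite ?e // hj // addr0.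
- right; apply/matrixP => j k; rewrite ord1 !mxE.
  by have [->|ji] := eqVneq j i; rewrite ?e // hj // subr0.
Qed.

Lemma mem_nbrs x y : (y \in nbrs x) = adj x y.
Proof.
rewrite mem_cat; apply/orP/adjP.
  by case=> /mapP[i _ ->]; exists i; [left|right].
by case=> i [->|->]; [left|right]; apply: map_f; rewrite mem_enum.
Qed.

Lemma uniq_nbrs x : uniq (nbrs x).
Proof.
have inj_unitv : injective (@unitv d).
  move=> i j /matrixP/(_ i 0); rewrite !mxE !eqxx andbT /=.
  by case: eqVneq.
rewrite cat_uniq; apply/and3P; split.
- rewrite map_inj_uniq ?enum_uniq // => i j h.
  by apply: inj_unitv; apply: (addrI x).
- apply/hasPn => _ /mapP[i _ ->]; apply/negP => /mapP[j _ h].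
  have /matrixP/(_ i 0) : - unitv i = unitv j by apply: (addrI x).
  by rewrite !mxE !eqxx /=; case: (i == j).
- rewrite map_inj_uniq ?enum_uniq // => i j h.
  by apply: inj_unitv; apply: oppr_inj; apply: (addrI x).
Qed.

Lemma mem_QN N x : (x \in QN d N) = [forall i, 1 <= x i 0 <= N%:Z].
Proof.
apply/mapP/forallP => [[f _ ->] i|h].
  by rewrite mxE /=; exact: ltn_ord.
have hk i : ((absz (x i 0)%R).-1 < N)%N by have := h i; lia.
exists (\col_i Ordinal (hk i)); first by rewrite mem_enum.
by apply/matrixP => i j; rewrite ord1 !mxE /=; have := h i; lia.
Qed.

Lemma uniq_QN N : uniq (QN d N).
Proof.
rewrite map_inj_uniq ?enum_uniq // => f g /matrixP h; apply/matrixP => i j.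
by have := h i j; rewrite !mxE => -[] /val_inj.
Qed.

Definition perpair_spec N x y (p : Zd d * Zd d) : Prop :=
  [/\ forall i, (0 <= p.1 i 0 <= N%:Z) && (0 <= p.2 i 0 <= N%:Z),
      (p.1 \in QN d N) || (p.2 \in QN d N)
    & exists k : Zd d, p = (x + k *+ N, y + k *+ N)].

Let pershiftE N x y j : (0 < N)%N ->
  0 <= Num.max (x j 0) (y j 0) - 1 - pershift N x y j 0 * N%:Z < N%:Z.
Proof.
move=> N0; rewrite mxE; set m := _ - 1.
have Nn : (N%:Z != 0) by lia.
have := ltz_pmod m (_ : 0 < N%:Z); move: (modz_ge0 m Nn) (divz_eq m N%:Z).
move: (divz _ _) (modz _ _) => q r h ->; move: (q * _) => A /(_ _); lia.
Qed.

Let maxz_cases (a b : int) :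
  Num.max a b = a /\ b <= a \/ Num.max a b = b /\ a <= b.
Proof. by case: (leP a b) => h; [right | left; split => //; exact: ltW]. Qed.

Let shiftE N x k j : (x + k *+ N : Zd d) j 0 = x j 0 + k j 0 * N%:Z.
Proof. by rewrite mxE mulmxnE pmulrn mulrzz. Qed.

Lemma perpairP N x y : (0 < N)%N -> adj x y -> perpair_spec N x y (perpair N x y).
Proof.
move=> N0 /adjP[i hi].
have pE z j : (z - pershift N x y *+ N) j 0 = z j 0 - pershift N x y j 0 * N%:Z.
  by rewrite -mulNrn shiftE mxE mulNr.
have key j : exists A m : int, [/\ forall z : Zd d, (z - pershift N x y *+ N) j 0 = z j 0 - A,
    0 <= m - 1 - A < N%:Z & m = x j 0 /\ y j 0 <= x j 0 \/ m = y j 0 /\ x j 0 <= y j 0].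
  exists (pershift N x y j 0 * N%:Z), (Num.max (x j 0) (y j 0)).
  by split; [move=> z; rewrite pE | exact: pershiftE | exact: maxz_cases].
have hyi : y i 0 = x i 0 + 1 \/ y i 0 = x i 0 - 1.
  by case: hi => ->; rewrite !mxE !eqxx; [left|right].
have hyj j : j != i -> y j 0 = x j 0.
  by move=> ji; case: hi => ->; rewrite !mxE (negbTE ji) ?addr0 ?subr0.
split=> [j||] /=; last by exists (- pershift N x y); rewrite mulNrn.
- have [A [m [pA hm hmxy]]] := key j; rewrite !pA; clear pA.
  by have [ji|/hyj hj] := eqVneq j i; [subst j|]; lia.
- rewrite !mem_QN; apply/orP; case: (hyi) => hy; [right|left];
  apply/forallP => j; have [A [m [pA hm hmxy]]] := key j; rewrite pA; clear pA;
  by have [ji|/hyj hj] := eqVneq j i; [subst j|]; lia.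
Qed.

Lemma perpair_uniq N x y p :
  (0 < N)%N -> perpair_spec N x y p -> p = perpair N x y.
Proof.
move=> N0 [hb hQ [k pk]]; rewrite pk /perpair; suff -> : k = - pershift N x y.
  by rewrite mulNrn.
apply/matrixP => j j0; rewrite ord1 [RHS]mxE.
have := maxz_cases (x j 0) (y j 0); have := pershiftE x y j N0; have := hb j.
have : (1 <= p.1 j 0) || (1 <= p.2 j 0).
  by case/orP: hQ; rewrite mem_QN => /forallP/(_ j) /andP[-> _] //; rewrite orbT.
rewrite pk /= !shiftE; move: (pershift _ _ _ _ _) (k j 0) (x j 0) (y j 0).
move=> q kj X Y; move: (Num.max X Y) => M h1 h2 h3 h4.
have : (q + kj) * N%:Z < N%:Z /\ - N%:Z < (q + kj) * N%:Z by rewrite mulrDl; lia.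
by case=> h5 h6; nia.
Qed.

End LatticeFacts.

Section Environment.
Variables (R : realType) (d : nat).
Implicit Types (a : edge d -> R) (N : nat) (x y : Zd d).

(* a(x, y) = a(y, x) on neighbours, and 0 on pairs that are not neighbours. *)
Definition cond a x y : R :=
  \sum_(i < d) ((y == x + unitv i)%:R * a (x, i) + (x == y + unitv i)%:R * a (y, i)).

Definition pcond N a x y : R := cond a (perpair N x y).1 (perpair N x y).2.

Definition pmass N a x : R := \sum_(y <- nbrs x) pcond N a x y.

Definition ptrans N a x y : R := pcond N a x y / pmass N a x.

Definition Hop N a (V : lmodType R) (u : Zd d -> V) x : V :=
  u x - \sum_(y <- nbrs x) ptrans N a x y *: u y.

Definition pinv_meas N a x : R := pmass N a x / \sum_(z <- QN d N) pmass N a z.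

Definition emb x : 'cV[R]_d := map_mx intr x.

Definition is_corrector N a (chi : Zd d -> 'cV[R]_d) : Prop :=
  [/\ forall x i, chi (x + unitv i *+ N) = chi x,
      \sum_(x <- QN d N) pmass N a x *: chi x = 0
    & forall x, Hop N a chi x = - Hop N a emb x].

(* The default value 0 is used only when there is no unique solution, which
   happens only outside of the event that all conductances are positive. The
   uniqueness clause makes the choice of xget immaterial, so that the corrector
   depends measurably on the conductances. *)
Definition corrector N a : Zd d -> 'cV[R]_d :=
  xget (fun=> 0) [set chi | unique (is_corrector N a) chi].

Definition vN N a x : 'cV[R]_d := emb x + corrector N a x.

Definition diffusion N a : 'M[R]_d :=
  \sum_(x <- QN d N) pinv_meas N a x *:
    \sum_(y <- nbrs x) ptrans N a x y *:
      ((vN N a y - vN N a x) *m (vN N a y - vN N a x)^T).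

Lemma condC a x y : cond a x y = cond a y x.
Proof. by apply: eq_bigr => i _; rewrite addrC. Qed.

Lemma cond_edge a x i : cond a x (x + unitv i) = a (x, i).
Proof.
have eq1 j : (x + unitv i == x + unitv j) = (i == j).
  apply/eqP/eqP => [h|-> //].
  have /matrixP/(_ i 0) : unitv i = unitv j by apply: (addrI x).
  by rewrite !mxE !eqxx andbT /=; case: eqVneq.
have eq2 j : (x == x + unitv i + unitv j) = false.
  apply/eqP => /matrixP/(_ i 0); rewrite !mxE !eqxx andbT.
  by case: (i == j) => /=; lia.
rewrite /cond (bigD1 i) //= big1 => [|j ji].
  by rewrite eq1 eq2 eqxx mul1r mul0r !addr0.
by rewrite eq1 eq2 eq_sym (negbTE ji) !mul0r addr0.
Qed.

End Environment.

Section Hoelder.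
Variables (R : realType) (d : nat).

(* u is total, but only its values on |x - z| <= 2N + 1 matter; the supremum is
   a maximum, over a finite nonempty set. *)
Definition holder_exponent (kappa alpha : R) : Prop :=
  0 < alpha /\
  exists C' : R,
  forall a : edge d -> R, (forall e, kappa^-1 <= a e <= kappa) ->
  forall N : nat, (1 <= N)%N ->
  forall (z : Zd d) (u : Zd d -> R),
    (forall x, (normoo (x - z)%R <= 2 * N)%N ->
       \sum_(y <- nbrs x) cond a x y * (u x - u y) = 0) ->
  forall x y, (normoo (x - z)%R <= N)%N -> (normoo (y - z)%R <= N)%N ->
    `|u x - u y| <=
      C' * ((normoo (x - y)%R)%:R / N%:R) `^ alpha
         * sup [set `|u w| | w in [set w | (normoo (w - z)%R <= 2 * N)%N]].

(* 2 nu(d) = max(alpha, d - 4 + alpha) *)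
Definition nu (alpha : R) : R := Num.max alpha (d%:R - 4 + alpha) / 2.

End Hoelder.

Section Iid.
Context {disp : measure_display} {T : measurableType disp} {R : realType}.
Variables (P : probability T R) (I : eqType).
Implicit Type X : I -> {RV P >-> R}.

Definition mutually_independent X : Prop :=
  forall (s : seq I) (B : I -> set R), uniq s ->
    (forall i, measurable (B i)) ->
    P (\bigcap_(i in [set` s]) (X i @^-1` B i)) = (\prod_(i <- s) P (X i @^-1` B i))%E.

Definition identically_distributed X : Prop :=
  forall (i j : I) (B : set R), measurable B ->
    distribution P (X i) B = distribution P (X j) B.

Definition iid X : Prop := mutually_independent X /\ identically_distributed X.

End Iid.

(* Main.v *)
From HB Require Import structures.
Require Import Defs.
From mathcomp Require Import all_boot all_order all_algebra.
From mathcomp Require Import all_classical all_reals all_analysis.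
From mathcomp Require Import measurable_realfun ring lra zify.
Set Implicit Arguments.
Unset Strict Implicit.
Unset Printing Implicit Defensive.
Import Order.TTheory GRing.Theory Num.Theory.
Import numFieldNormedType.Exports.
Local Open Scope classical_set_scope.
Local Open Scope ring_scope.

(** The periodized diffusion matrix is a function of the finitely many
    independent conductances of the torus (Z/NZ)^d. It concentrates because the
    squared influences of the single edges have a sum that is bounded for every
    environment, not only on average.

    Write v_j = x_j + chi_j for the harmonic coordinates and s_j(e) for the
    increment of v_j along the edge e. In an elliptic environment D_jk is the
    ratio of the energy sum_e a(e) s_j(e) s_k(e) and of sum_e a(e). As v_j is
    harmonic, its flow is orthogonal to periodic gradients. Hence, if a and a'
    differ at one edge e only, the two energies differ by exactly
    (a(e) - a'(e)) s_j(e) s'_k(e) (energy_one_edge), and the same orthogonality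
    gives |s'_k(e)| <= (1 + kappa^2) |s_k(e)| (cslope_one_edge). So the influence
    of e on D_jk is at most of order N^-d (|s_j(e)| |s_k(e)| + 1)
    (tdiff_one_edge). Comparison with the affine coordinates bounds
    sum_e s_k(e)^2 by a multiple of N^d (sum_sqr_cslope), so the squared
    influences add up to at most C N^-d (G^2 + 1), where G bounds all |s_j(e)|
    (sum_influence).

    The Hoelder estimate bounds G. Applied to v_j in a box of side L N, where L is
    a large constant, it shows that over one period v_j oscillates by at most a
    small multiple of its size L N + osc(chi_j) in the large box. This absorbs
    osc(chi_j), which is therefore of order N. The same estimate at two
    neighbouring points then gives G <= C N^(1 - alpha) (corrector_slope_le). In
    dimension one the flow of v_j is constant, so that G <= kappa^2
    (corrector_slope_le_dim1). Testing the regularity estimate on a coordinate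
    function of the homogeneous lattice shows that alpha <= 1
    (holder_exponent_le1), and in all dimensions the squared influences add up to
    at most V = V0 N^(-2 nu) (influence_bound).

    It remains to turn such a bound V into tails. The Efron-Stein inequality
    (efron_stein), which gives the bound on the variance, is also applied to
    exp(l f / 2). It yields M(l) (1 - l^2 V / 4) <= M(l / 2)^2 for the moment
    generating function M of f (mgf_halving). Iterating this down to small l shows
    that M(l) <= 2 exp(l E f) as long as l^2 V <= 1, and an exponential Markov
    inequality concludes (exponential_tail).

    These inequalities are proved for bounded functions on the space of finite
    tuples, so the conductances are truncated to [1/kappa, kappa], which almost
    surely changes nothing. The diffusion matrix must nevertheless be
    measurable for arbitrary conductances. This is obtained by solving the
    corrector equation with Cramer's rule whenever it has a unique solution
    (correctorE, measurable_tdiff). *)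

(** * Concentration for functions of independent coordinates *)

Section BoundedExpectation.
Context d (T : measurableType d) (R : realType) (mu : probability T R).

(** Bounded functions form an algebra on which all integrals below are finite,
    so that no integrability condition has to be carried around. *)
Definition bmeas (f : T -> R) : Prop :=
  measurable_fun [set: T] f /\ exists M, forall x, `|f x| <= M.

Definition mean (f : T -> R) : R := \int[mu]_x f x.

Lemma bmeas_integrable f : bmeas f -> mu.-integrable setT (EFin \o f).
Proof.
move=> [mf [M hM]].
have fin : (mu [set: T] < +oo)%E by rewrite probability_setT ltry.
apply: measurable_bounded_integrable => //.
exists M; split; first exact: num_real.
by move=> r Mr x _; apply: le_trans (hM x) (ltW Mr).
Qed.

Lemma bmeas_cst c : bmeas (fun=> c).
Proof. by split; [exact: measurable_cst | exists `|c|]. Qed.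

Lemma bmeasD f g : bmeas f -> bmeas g -> bmeas (fun x => f x + g x).
Proof.
move=> [mf [M hM]] [mg [M' hM']]; split; first exact: measurable_funD.
by exists (M + M') => x; apply: le_trans (ler_normD _ _) _; exact: lerD.
Qed.

Lemma bmeasM f g : bmeas f -> bmeas g -> bmeas (fun x => f x * g x).
Proof.
move=> [mf [M hM]] [mg [M' hM']]; split; first exact: measurable_funM.
by exists (M * M') => x; rewrite normrM; exact: ler_pM.
Qed.

Lemma bmeasB f g : bmeas f -> bmeas g -> bmeas (fun x => f x - g x).
Proof.
move=> hf hg; have := bmeasD hf (bmeasM (bmeas_cst (-1)) hg).
by congr bmeas; apply/funext => x; rewrite mulN1r.
Qed.

Lemma bmeasX f : bmeas f -> bmeas (fun x => f x ^+ 2).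
Proof. by move=> hf; apply: bmeasM. Qed.

Lemma bmeas_expR f : bmeas f -> bmeas (fun x => expR (f x)).
Proof.
move=> [mf [M hM]]; split; first exact: measurableT_comp.
by exists (expR M) => x; rewrite ger0_norm ?expR_ge0// ler_expR (le_trans (ler_norm _)).
Qed.

Lemma bmeas_sum (I : Type) (r : seq I) (F : I -> T -> R) :
  (forall i, bmeas (F i)) -> bmeas (fun x => \sum_(i <- r) F i x).
Proof.
move=> hF; elim: r => [|i r IH].
  by under eq_fun do rewrite big_nil; exact: bmeas_cst.
by under eq_fun do rewrite big_cons; exact: bmeasD.
Qed.

Lemma mean_cst c : mean (fun=> c) = c.
Proof. 
rewrite /mean Rintegral_cst//.
have -> : fine (mu [set: T]) = 1 by rewrite probability_setT.
by rewrite mulr1.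
 Qed.

Lemma meanD f g : bmeas f -> bmeas g -> mean (fun x => f x + g x) = mean f + mean g.
Proof. by move=> hf hg; apply: RintegralD => //; exact: bmeas_integrable. Qed.

Lemma meanZ c f : bmeas f -> mean (fun x => c * f x) = c * mean f.
Proof. by move=> hf; apply: RintegralZl => //; exact: bmeas_integrable. Qed.

Lemma meanB f g : bmeas f -> bmeas g -> mean (fun x => f x - g x) = mean f - mean g.
Proof. by move=> hf hg; apply: RintegralB => //; exact: bmeas_integrable. Qed.

Lemma mean_sum (I : Type) (r : seq I) (F : I -> T -> R) :
  (forall i, bmeas (F i)) ->
  mean (fun x => \sum_(i <- r) F i x) = \sum_(i <- r) mean (F i).
Proof.
move=> hF; elim: r => [|i r IH].
  by under eq_fun do rewrite big_nil; rewrite big_nil mean_cst.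
under eq_fun do rewrite big_cons.
by rewrite big_cons meanD ?IH//; exact: bmeas_sum.
Qed.

Lemma mean_le f g : bmeas f -> bmeas g -> (forall x, f x <= g x) -> mean f <= mean g.
Proof. by move=> hf hg h; apply: le_Rintegral => //; exact: bmeas_integrable. Qed.

End BoundedExpectation.
Arguments bmeas_cst {d T R}.

(** Since exp b >= exp a (1 + b - a), the difference of two exponentials is at
    most the larger one times |a - b|. The bound by the sum of both, rather than
    by their maximum, is the form that survives an exchange of a and b. *)
Lemma sqr_expRB (R : realType) (a b : R) :
  (expR a - expR b) ^+ 2 <= (a - b) ^+ 2 * (expR (2 * a) + expR (2 * b)).
Proof.
wlog ab : a b / b <= a.
  move=> h; have [/h//|/ltW /h] := leP b a.
  by congr (_ <= _); ring.
have h1 : expR a - expR b = expR a * (1 - expR (b - a)).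
  by rewrite mulrBr mulr1 -expRD; congr (_ - expR _); ring.
have h2 : expR (b - a) <= 1 by rewrite -expR0 ler_expR subr_le0.
have h3 : 1 + (b - a) <= expR (b - a) by exact: expR_ge1Dx.
rewrite h1 exprMn mulrDr -[leLHS]addr0 lerD//; last first.
  by rewrite mulr_ge0 ?sqr_ge0 ?expR_ge0.
have -> : expR (2 * a) = expR a ^+ 2 by rewrite expr2 -expRD; congr expR; ring.
rewrite mulrC ler_wpM2r ?sqr_ge0//.
by rewrite ler_sqr ?nnegrE; lra.
Qed.

(** From exp (- x) >= 1 - x and (1 + x + 2 x^2) (1 - x) = 1 + x^2 (1 - 2 x). *)
Lemma expR_le_quad (R : realType) (x : R) : x <= 2^-1 -> expR x <= 1 + x + 2 * x ^+ 2.
Proof.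
move=> hx; have h : 0 < 1 - x by lra.
have h1 : 1 - x <= expR (- x) by have := expR_ge1Dx (- x).
have h2 : expR x * (1 - x) <= 1.
  apply: (@le_trans _ _ (expR x * expR (- x))); last by rewrite expRxMexpNx_1.
  by rewrite ler_wpM2l ?expR_ge0.
have h3 : 1 <= (1 + x + 2 * x ^+ 2) * (1 - x).
  have : 0 <= x ^+ 2 * (1 - 2 * x) by rewrite mulr_ge0 ?sqr_ge0//; lra.
  nra.
by rewrite -(ler_pM2r h); exact: le_trans h3.
Qed.

Section Resampling.
Context (R : realType) (m : nat).
Notation U := (m.-tuple R).
Variable mu : probability U R.
Notation mu2 := (mu \x mu)%E.

Definition independent_coordinates : Prop :=
  forall B : 'I_m -> set R, (forall i, measurable (B i)) ->
    mu [set u | forall i, B i (tnth u i)] =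
    (\prod_(i < m) mu [set u | B i (tnth u i)])%E.

Definition mix (S : pred 'I_m) (u v : U) : U :=
  [tuple if S i then tnth v i else tnth u i | i < m].

(** Exchanging some coordinates of two independent copies of the sample preserves
    their joint law. This symmetry is the only consequence of independence that
    the Efron-Stein inequality needs; no conditional expectation occurs. *)
Definition exch (S : pred 'I_m) (p : U * U) : U * U :=
  (mix S p.1 p.2, mix S p.2 p.1).

Lemma tnth_mix S u v i : tnth (mix S u v) i = if S i then tnth v i else tnth u i.
Proof. by rewrite tnth_mktuple. Qed.

Lemma measurable_mix S : measurable_fun [set: U * U] (fun p => mix S p.1 p.2).
Proof.
apply/measurable_fun_tnthP => i; rewrite /comp.
under eq_fun do rewrite tnth_mix.
case: (S i).
  exact: (measurableT_comp (@measurable_tnth _ R m i) (@measurable_snd _ _ U U)).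
exact: (measurableT_comp (@measurable_tnth _ R m i) (@measurable_fst _ _ U U)).
Qed.

Lemma measurable_exch S : measurable_fun [set: U * U] (exch S).
Proof.
apply: measurable_fun_pair; first exact: measurable_mix.
exact: (measurableT_comp (@measurable_mix S) (@measurable_swap _ _ U U)).
Qed.

Definition rect (B B' : 'I_m -> set R) : set (U * U) :=
  [set p | forall i, B i (tnth p.1 i) /\ B' i (tnth p.2 i)].

Definition rects : set (set (U * U)) :=
  [set C | exists B B', (forall i, measurable (B i) /\ measurable (B' i)) /\ C = rect B B'].

Lemma measurable_box (B : 'I_m -> set R) : (forall i, measurable (B i)) ->
  measurable [set u : U | forall i, B i (tnth u i)].
Proof.
move=> mB.
have -> : [set u : U | forall i, B i (tnth u i)] = \bigcap_(i in [set: 'I_m]) [set u | B i (tnth u i)].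
  by apply/seteqP; split => u /= h; [move=> i _; exact: h | move=> i; exact: h].
apply: fin_bigcap_measurable => // i _.
rewrite -[X in measurable X]setTI; exact: measurable_tnth.
Qed.

Lemma rectE B B' : rect B B' =
  [set u | forall i, B i (tnth u i)] `*` [set u | forall i, B' i (tnth u i)].
Proof.
apply/seteqP; split => p /=; first by move=> h; split => i; case: (h i).
by case=> h h' i; split.
Qed.

Lemma measurable_rects : rects `<=` measurable.
Proof.
move=> _ [B [B' [h ->]]]; rewrite rectE.
by apply: measurableX; apply: measurable_box => i; case: (h i).
Qed.

(** The identity, seen as a map from the tuples with the sigma-algebra generated
    by the rectangles to the product space, has measurable coordinates and is
    therefore measurable. *)
Lemma rects_generate : measurable = <<s rects >>.
Proof.
apply/seteqP; split; last first.
  by apply: smallest_sub; [exact: sigma_algebra_measurable | exact: measurable_rects].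
pose W := g_sigma_algebraType rects.
have mid : measurable_fun [set: W] (fun p : W => (p.1, p.2) : U * U).
  apply: measurable_fun_pair.
    apply/measurable_fun_tnthP => i _ Y mY; rewrite setTI.
    apply: sub_sigma_algebra; exists (fun j => if j == i then Y else setT), (fun=> setT).
    split=> [j|]; first by split => //; case: ifP.
    apply/seteqP; split => p /=; first by move=> h j; split => //; case: eqP => [->|].
    by move/(_ i); rewrite eqxx => -[].
  apply/measurable_fun_tnthP => i _ Y mY; rewrite setTI.
  apply: sub_sigma_algebra; exists (fun=> setT), (fun j => if j == i then Y else setT).
  split=> [j|]; first by split => //; case: ifP.
  apply/seteqP; split => p /=; first by move=> h j; split => //; case: eqP => [->|].
  by move/(_ i); rewrite eqxx => -[].
move=> A mA; have := mid measurableT A mA; rewrite setTI.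
by have -> : (fun p : W => (p.1, p.2) : U * U) @^-1` A = A by apply/seteqP; split => -[].
Qed.

Hypothesis indep : independent_coordinates.

Lemma rect_measure B B' : (forall i, measurable (B i)) -> (forall i, measurable (B' i)) ->
  mu2 (rect B B') =
  (\prod_(i < m) (mu [set u | B i (tnth u i)] * mu [set u | B' i (tnth u i)]))%E.
Proof.
move=> mB mB'; rewrite rectE.
transitivity (mu [set u | forall i, B i (tnth u i)] *
              mu [set u | forall i, B' i (tnth u i)])%E.
  by apply: product_measure1E; exact: measurable_box.
by rewrite !indep// big_split.
Qed.

(** An exchange maps a rectangle to a rectangle and permutes the factors of the
    product that gives its measure; rectangles form a generating pi-system. *)
Lemma exch_invariant S A : measurable A -> mu2 (exch S @^-1` A) = mu2 A.
Proof.
move=> mA; have := @measure_unique _ R (U * U)%type rects (fun=> setT) rects_generate.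
move=> /(_ _ _ _ (pushforward mu2 (exch S)) mu2 _ _ A mA); apply.
- move=> _ _ [B1 [B1' [h1 ->]]] [B2 [B2' [h2 ->]]].
  exists (fun i => B1 i `&` B2 i), (fun i => B1' i `&` B2' i); split.
    by move=> i; case: (h1 i) => ? ?; case: (h2 i) => ? ?; split; exact: measurableI.
  apply/seteqP; split => p /=.
    by case=> k1 k2 i; case: (k1 i) => ? ?; case: (k2 i).
  by move=> k; split => i; case: (k i) => k1 k2; split; [case: k1|case: k2|case: k1|case: k2].
- by move=> _; exists (fun=> setT), (fun=> setT); split => //; apply/seteqP; split => // p _ i; split.
- by apply/seteqP; split => // p _; exists 0%N.
- exact: measurable_exch.
- move=> mS _ [B [B' [h ->]]].
  transitivity (mu2 (exch S @^-1` rect B B')); first by [].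
  have -> : exch S @^-1` rect B B' =
      rect (fun i => if S i then B' i else B i) (fun i => if S i then B i else B' i).
    apply/seteqP; split => p /= k i; move: (k i); rewrite !tnth_mix;
      case: (S i) => hi; split; by case: hi.
  rewrite -[RHS]/(mu2 (rect B B')).
  rewrite !rect_measure; try by move=> i; case: (h i) => // ? ?; case: ifP.
  by apply: eq_bigr => i _; case: (S i) => //; rewrite muleC.
- by move=> mS _; rewrite -[ltLHS]/(mu2 setT) probability_setT ltry.
Qed.

Lemma mean_exch S F : bmeas F -> mean mu2 (fun p => F (exch S p)) = mean mu2 F.
Proof.
move=> bF; have mF : measurable_fun setT (EFin \o F).
  by apply/measurable_EFinP; case: bF.
rewrite /mean /Rintegral; congr fine.
have := @integral_pushforward _ _ _ _ R (exch S) (measurable_exch S) mu2 setT (EFin \o F) mF.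
rewrite preimage_setT => <- //.
  apply: eq_measure_integral; first exact: measurable_exch.
  by move=> mS A mA _; exact: exch_invariant.
apply: bmeas_integrable; split; first by apply: measurableT_comp; [case: bF|exact: measurable_exch].
by case: bF => _ [M hM]; exists M => p; exact: hM.
Qed.

Lemma bmeas_comp (d d' : measure_display) (T : measurableType d) (T' : measurableType d')
    (g : T -> T') (f : T' -> R) :
  measurable_fun setT g -> bmeas f -> bmeas (fun x => f (g x)).
Proof.
by move=> mg [mf [M hM]]; split; [exact: (measurableT_comp mf mg) | exists M => p; exact: hM].
Qed.

Lemma mean_iterated F : bmeas F ->
  mean mu2 F = mean mu (fun x => mean mu (fun y => F (x, y))).
Proof.
move=> bF; rewrite /mean /Rintegral; congr fine.
rewrite -(integral12_prod_meas1 (bmeas_integrable mu2 bF)).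
apply: eq_integral => x _; rewrite /fubini_F fineK//.
apply: (@integrable_fin_num _ _ _ mu setT measurableT (fun y => (F (x, y))%:E)).
apply: (@bmeas_integrable _ _ _ mu (fun y => F (x, y))).
apply: (@bmeas_comp _ _ U (U * U)%type (fun y => (x, y)) F) => //.
exact: measurable_fun_pair.
Qed.

Lemma mean_fst f : bmeas f -> mean mu2 (fun p => f p.1) = mean mu f.
Proof.
move=> bf; rewrite mean_iterated; last exact: bmeas_comp.
congr (mean _ _); apply/funext => x; exact: (mean_cst mu (f x)).
Qed.

Lemma mean_prod f : bmeas f -> mean mu2 (fun p => f p.1 * f p.2) = mean mu f ^+ 2.
Proof.
move=> bf; rewrite mean_iterated; last by apply: bmeasM; exact: bmeas_comp.
transitivity (mean mu (fun x => mean mu f * f x)); last by rewrite meanZ// expr2.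
by congr (mean _ _); apply/funext => x; rewrite mulrC; exact: (meanZ mu (f x) bf).
Qed.

Definition resample (k : 'I_m) (p : U * U) : U := mix (pred1 k) p.1 p.2.

(** Let H j be f at the sample whose first j coordinates are replaced by those of
    the independent copy. The variance is E f (H 0 - H m), which telescopes. In
    the k-th term, exchanging the k-th coordinates swaps H k and H k.+1 and turns
    f into its resampled value r, so twice the term is
    E (f - r) (H k - H k.+1). Exchanging the first k coordinates shows that the
    two factors have the same second moment, and 2 x y <= x^2 + y^2 concludes. *)
Lemma efron_stein f : bmeas f ->
  mean mu (fun u => f u ^+ 2) - mean mu f ^+ 2 <=
  2^-1 * \sum_(k < m) mean mu2 (fun p => (f p.1 - f (resample k p)) ^+ 2).
Proof.
move=> bf.
pose H (j : nat) (p : U * U) := f (mix (fun i : 'I_m => (i < j)%N) p.1 p.2).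
have bH j : bmeas (H j) by apply: bmeas_comp => //; exact: measurable_mix.
have bf1 : bmeas (fun p : U * U => f p.1) by apply: bmeas_comp.
have bf2 : bmeas (fun p : U * U => f p.2) by apply: bmeas_comp.
have br k : bmeas (fun p : U * U => f (resample k p)).
  by apply: bmeas_comp => //; exact: measurable_mix.
have H0 p : H 0%N p = f p.1.
  by rewrite /H; congr f; apply: eq_from_tnth => i; rewrite tnth_mix.
have Hm p : H m p = f p.2.
  by rewrite /H; congr f; apply: eq_from_tnth => i; rewrite tnth_mix ltn_ord.
have bt k : bmeas (fun p : U * U => f p.1 * (H k p - H k.+1 p)).
  by apply: bmeasM => //; exact: bmeasB.
have -> : mean mu (fun u => f u ^+ 2) - mean mu f ^+ 2 =
    \sum_(k < m) mean mu2 (fun p => f p.1 * (H k p - H k.+1 p)).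
  rewrite -mean_prod// -(mean_fst (bmeasX bf)) -meanB; [|by apply: bmeasX|exact: bmeasM].
  rewrite -mean_sum//; congr (mean _ _); apply/funext => p.
  rewrite -mulr_sumr expr2 -mulrBr -(big_mkord xpredT (fun k => H k p - H k.+1 p)).
  rewrite (eq_bigr (fun k => - (H k.+1 p - H k p))); last by move=> k _; rewrite opprB.
  by rewrite sumrN telescope_sumr// H0 Hm opprB.
rewrite mulr_sumr; apply: ler_sum => k _.
set a := fun p : U * U => f p.1; set r := fun p : U * U => f (resample k p).
set b := H k; set c := H k.+1.
have ba : bmeas a := bf1.
have brk : bmeas r := br k.
have bb : bmeas b := bH k.
have bc : bmeas c := bH k.+1.
have e1 : mean mu2 (fun p => a p * (b p - c p)) = mean mu2 (fun p => r p * (c p - b p)).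
  rewrite -(mean_exch (pred1 k))//; last exact: bt.
  congr (mean _ _); apply/funext => p; rewrite /a /r /b /c /H /=.
  congr (_ * (f _ - f _)); apply: eq_from_tnth => i; rewrite !tnth_mix/=; have [->|/negbTE ik] := eqVneq i k;
    by rewrite ?ltnS ?ltnn ?leqnn// (leq_eqVlt i k) (ik : (i == k :> nat) = false).
have e2 : mean mu2 (fun p => (b p - c p) ^+ 2) = mean mu2 (fun p => (a p - r p) ^+ 2).
  rewrite -(mean_exch (fun i : 'I_m => (i < k)%N)); last by apply: bmeasX; exact: bmeasB.
  congr (mean _ _); apply/funext => p; rewrite /a /r /b /c /H /=.
  congr ((f _ - f _) ^+ 2); apply: eq_from_tnth => i; rewrite !tnth_mix/=.
    by case: ltnP.
  have [->|ik] := eqVneq i k; first by rewrite ltnn ltnSn.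
  by rewrite ltnS (leq_eqVlt i k) (negbTE ik : (i == k :> nat) = false)/=; case: ltnP.
have bar : bmeas (fun p => (a p - r p) ^+ 2) by apply: bmeasX; exact: bmeasB.
have bbc : bmeas (fun p => (b p - c p) ^+ 2) by apply: bmeasX; exact: bmeasB.
have bm : bmeas (fun p => (a p - r p) * (b p - c p)) by apply: bmeasM; exact: bmeasB.
have e3 : 2 * mean mu2 (fun p => a p * (b p - c p)) =
    mean mu2 (fun p => (a p - r p) * (b p - c p)).
  rewrite mulrDl mul1r {2}e1 -meanD; [|exact: bt|]; last first.
    by apply: bmeasM; [exact: br | exact: bmeasB].
  by congr (mean _ _); apply/funext => p; ring.
have : mean mu2 (fun p => (a p - r p) * (b p - c p)) <=
    mean mu2 (fun p => 2^-1 * ((a p - r p) ^+ 2 + (b p - c p) ^+ 2)).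
  apply: mean_le => //; first by apply: bmeasM; [exact: bmeas_cst | exact: bmeasD].
  move=> p; have := sqr_ge0 ((a p - r p) - (b p - c p)); rewrite sqrrB; lra.
rewrite -e3 meanZ ?meanD ?e2//; last exact: bmeasD.
lra.
Qed.

Lemma mean_exch_resample k F : bmeas F ->
  mean mu2 (fun p => F (exch (pred1 k) p)) = mean mu2 F.
Proof. exact: mean_exch. Qed.

Lemma resample_exch k p : resample k (exch (pred1 k) p) = p.1.
Proof.
by apply: eq_from_tnth => i; rewrite !tnth_mix/=; case: eqP.
Qed.

Section Concentration.
Variables (f : U -> R) (V : R).
Hypothesis bf : bmeas f.
Hypothesis hV : forall p : U * U, \sum_(k < m) (f p.1 - f (resample k p)) ^+ 2 <= V.

Let bf1 : bmeas (fun p : U * U => f p.1). Proof. exact: bmeas_comp. Qed.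
Let br k : bmeas (fun p : U * U => f (resample k p)).
Proof. by apply: bmeas_comp => //; exact: measurable_mix. Qed.

Lemma variance_le : mean mu (fun u => f u ^+ 2) - mean mu f ^+ 2 <= V / 2.
Proof.
apply: le_trans (efron_stein bf) _; rewrite mulrC ler_wpM2r ?invr_ge0//.
rewrite -mean_sum; last by move=> k; apply: bmeasX; exact: bmeasB.
rewrite -(mean_cst mu2 V); apply: mean_le => //; last exact: bmeas_cst.
by apply: bmeas_sum => k; apply: bmeasX; exact: bmeasB.
Qed.

Definition mgf l := mean mu (fun u => expR (l * f u)).

Let bexp l : bmeas (fun u => expR (l * f u)).
Proof. by apply: bmeas_expR; apply: bmeasM => //; exact: bmeas_cst. Qed.

Lemma mgf_ge0 l : 0 <= mgf l.
Proof.
by rewrite -(mean_cst mu 0); apply: mean_le => //; exact: bmeas_cst.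
Qed.

(** The Efron-Stein inequality for exp (l f / 2). The exponentials of the
    resampled values that sqr_expRB produces are moved back to the original
    sample by an exchange, so that the sum of the squared influences appears at
    one sample point, where it is at most V. *)
Lemma mgf_halving l : mgf l * (1 - l ^+ 2 * V / 4) <= mgf (l / 2) ^+ 2.
Proof.
have := efron_stein (bexp (l / 2)).
have -> : mean mu (fun u => expR (l / 2 * f u) ^+ 2) = mgf l.
  congr (mean _ _); apply/funext => u; rewrite expr2 -expRD; congr expR; lra.
rewrite -/(mgf (l / 2)) => hES.
suff : 2^-1 * \sum_(k < m) mean mu2
    (fun p => (expR (l / 2 * f p.1) - expR (l / 2 * f (resample k p))) ^+ 2) <=
    l ^+ 2 * V / 4 * mgf l by lra.
have bk k : bmeas (fun p : U * U => (f p.1 - f (resample k p)) ^+ 2 * expR (l * f p.1)).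
  by apply: bmeasM; [apply: bmeasX; exact: bmeasB | exact: (bmeas_comp _ (bexp l))].
have bk' k : bmeas (fun p : U * U => (f p.1 - f (resample k p)) ^+ 2 * expR (l * f (resample k p))).
  apply: bmeasM; first by apply: bmeasX; exact: bmeasB.
  by apply: (bmeas_comp _ (bexp l)); exact: measurable_mix.
have hk k : mean mu2 (fun p => (expR (l / 2 * f p.1) - expR (l / 2 * f (resample k p))) ^+ 2) <=
    l ^+ 2 / 2 * mean mu2 (fun p => (f p.1 - f (resample k p)) ^+ 2 * expR (l * f p.1)).
  have hsym : mean mu2 (fun p => (f p.1 - f (resample k p)) ^+ 2 * expR (l * f (resample k p))) =
     mean mu2 (fun p => (f p.1 - f (resample k p)) ^+ 2 * expR (l * f p.1)).
    rewrite -(mean_exch_resample k (bk k)); congr (mean _ _); apply/funext => p.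
    by rewrite resample_exch -sqrrN opprB.
  apply: (@le_trans _ _ (mean mu2 (fun p => l ^+ 2 / 4 *
    ((f p.1 - f (resample k p)) ^+ 2 * expR (l * f p.1) +
     (f p.1 - f (resample k p)) ^+ 2 * expR (l * f (resample k p)))))).
    apply: mean_le.
    - apply: bmeasX; apply: bmeasB; first exact: (bmeas_comp _ (bexp (l / 2))).
      by apply: (bmeas_comp _ (bexp (l / 2))); exact: measurable_mix.
    - by apply: bmeasM; [exact: bmeas_cst | exact: bmeasD].
    - move=> p; apply: le_trans (sqr_expRB _ _) _.
      have e2 (x : R) : 2 * (l / 2 * x) = l * x by field.
      by rewrite !e2 le_eqVlt; apply/orP; left; apply/eqP; field.
  rewrite meanZ; last exact: bmeasD.
  by rewrite meanD// hsym le_eqVlt; apply/orP; left; apply/eqP; field.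
apply: (@le_trans _ _ (2^-1 * (l ^+ 2 / 2 * (V * mgf l)))); last first.
  by rewrite le_eqVlt; apply/orP; left; apply/eqP; field.
rewrite ler_wpM2l ?invr_ge0//; apply: le_trans (ler_sum _ (fun k _ => hk k)) _.
rewrite -mulr_sumr ler_wpM2l//; first by rewrite divr_ge0 ?sqr_ge0.
rewrite -mean_sum// /mgf -meanZ// -(mean_fst (f := fun u => V * expR (l * f u))); last first.
  by apply: bmeasM => //; exact: bmeas_cst.
apply: mean_le; first exact: bmeas_sum.
  by apply: bmeasM; [exact: bmeas_cst | exact: (bmeas_comp _ (bexp l))].
by move=> p; rewrite -mulr_suml ler_wpM2r ?expR_ge0.
Qed.

Lemma influence_ge0 : 0 <= V.
Proof.
have [u _] : exists u : U, True by exists [tuple 0 | i < m].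
by apply: le_trans (hV (u, u)); apply: sumr_ge0 => k _; exact: sqr_ge0.
Qed.

(** The factor 1 - s / 2 is reproduced by the recursion, because
    (1 - s / 4) (1 - s / 8)^2 >= 1 - s / 2 for s = l^2 V. *)
Lemma mgf_iter n l : l ^+ 2 * V <= 1 ->
  mgf l * (1 - l ^+ 2 * V / 2) <= mgf (l / 2 ^+ n) ^+ (2 ^ n).
Proof.
elim: n l => [|n IH] l hl.
  rewrite expr0 divr1 expr1 ler_piMr ?mgf_ge0//.
  have : 0 <= l ^+ 2 * V by rewrite mulr_ge0 ?sqr_ge0 ?influence_ge0.
  lra.
have s0 : 0 <= l ^+ 2 * V by rewrite mulr_ge0 ?sqr_ge0 ?influence_ge0.
have hl2 : (l / 2) ^+ 2 * V = l ^+ 2 * V / 4 by field.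
have hl4 : l ^+ 2 * V / 4 <= 1 by lra.
have := IH (l / 2); rewrite hl2 => /(_ hl4) h1; have h2 := mgf_halving l.
set s := l ^+ 2 * V in s0 hl hl2 hl4 h1 h2 *.
rewrite exprS invfM mulrA expnSr exprM.
have h3 : (mgf (l / 2) * (1 - s / 4 / 2)) ^+ 2 <= (mgf (l / 2 / 2 ^+ n) ^+ (2 ^ n)) ^+ 2.
  by rewrite ler_sqr ?nnegrE ?exprn_ge0 ?mgf_ge0// mulr_ge0 ?mgf_ge0//; lra.
apply: le_trans h3; rewrite exprMn.
apply: (@le_trans _ _ (mgf l * (1 - s / 4) * (1 - s / 4 / 2) ^+ 2)); last first.
  by rewrite ler_wpM2r ?sqr_ge0.
by rewrite -mulrA ler_wpM2l ?mgf_ge0//; nra.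
Qed.

(** For a centred f, M(l / 2^n) is at most exp(2 l^2 B^2 / 4^n), where B bounds
    |f|. Its power of exponent 2^n tends to 1, so the iterated recursion gives
    M(l) (1 - l^2 V / 2) <= 1. *)
Lemma mgf_le2 l : mean mu f = 0 -> l ^+ 2 * V <= 1 -> mgf l <= 2.
Proof.
move=> f0 hl; have [_ [B hB]] := bf.
have B0 : 0 <= B by have := hB [tuple 0 | i < m]; apply: le_trans.
have hmu mu' : `|mu'| * B <= 2^-1 -> mgf mu' <= expR (2 * mu' ^+ 2 * B ^+ 2).
  move=> hm; apply: le_trans (expR_ge1Dx _).
  have -> : 1 + 2 * mu' ^+ 2 * B ^+ 2 = mean mu (fun u => (1 + 2 * mu' ^+ 2 * B ^+ 2) + mu' * f u).
    by rewrite meanD ?meanZ ?f0 ?mean_cst ?mulr0 ?addr0//; [exact: bmeas_cst|apply: bmeasM => //; exact: bmeas_cst].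
  apply: mean_le => //.
    by apply: bmeasD; [exact: bmeas_cst | apply: bmeasM => //; exact: bmeas_cst].
  move=> u; apply: le_trans (expR_le_quad _) _.
    by apply: le_trans hm; apply: le_trans (ler_norm _) _; rewrite normrM ler_wpM2l.
  have : (mu' * f u) ^+ 2 <= mu' ^+ 2 * B ^+ 2.
    rewrite exprMn ler_wpM2l ?sqr_ge0// -[leLHS](real_normK (num_real _)) ler_sqr ?nnegrE ?normr_ge0//.
  lra.
suff : mgf l * (1 - l ^+ 2 * V / 2) <= 1.
  have := mgf_ge0 l; nra.
rewrite leNgt; apply/negP => hX; set X := mgf l * _ in hX.
pose c := 2 * l ^+ 2 * B ^+ 2.
have c0 : 0 <= c by apply: mulr_ge0; [apply: mulr_ge0|]; rewrite ?sqr_ge0.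
have lX : 0 < ln X by rewrite ln_gt0.
have [n hn] : exists n : nat, c / ln X < 2 ^+ n /\ 2 * (`|l| * B) < 2 ^+ n.
  pose K := c / ln X + 2 * (`|l| * B).
  have K1 : 0 <= c / ln X := divr_ge0 c0 (ltW lX).
  have K2 : 0 <= 2 * (`|l| * B) by rewrite mulr_ge0// mulr_ge0.
  have K0 : 0 <= K by rewrite addr_ge0.
  exists (Num.bound K); have hK : K < 2 ^+ Num.bound K.
    apply: lt_trans (archi_boundP K0) _; rewrite -natrX ltr_nat; exact: ltn_expl.
  by split; apply: le_lt_trans hK; rewrite /K ?lerDl ?lerDr.
case: hn => hn1 hn2.
have p0 : 0 < 2 ^+ n :> R by rewrite exprn_gt0.
have h1 := mgf_iter n hl; rewrite -/X in h1.
have h2 : mgf (l / 2 ^+ n) <= expR (c / (2 ^+ n) ^+ 2).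
  apply: le_trans (hmu _ _) _.
    rewrite normrM normfV (ger0_norm (ltW p0)) mulrAC ler_pdivrMr//; lra.
  by rewrite ler_expR /c expr_div_n; rewrite le_eqVlt; apply/orP; left; apply/eqP; field; rewrite lt0r_neq0.
have h3 : X <= expR (c / 2 ^+ n).
  apply: le_trans h1 _; apply: (@le_trans _ _ (expR (c / (2 ^+ n) ^+ 2) ^+ (2 ^ n))).
    by rewrite lerXn2r ?nnegrE ?mgf_ge0 ?expR_ge0.
  rewrite -expRM_natl natrX ler_expR le_eqVlt; apply/orP; left; apply/eqP; field.
  by rewrite lt0r_neq0.
have : ln X <= c / 2 ^+ n.
  by rewrite -(expRK (c / 2 ^+ n)) ler_ln ?posrE ?expR_gt0// (lt_trans _ hX).
by rewrite ler_pdivlMr// leNgt -ltr_pdivrMl// mulrC hn1.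
Qed.

End Concentration.

(** The indicator of the tail event times exp (l t) is at most
    exp (l g) + exp (- l g), where g is the centred function. *)
Lemma exponential_tail f V l t : bmeas f ->
  (forall p : U * U, \sum_(k < m) (f p.1 - f (resample k p)) ^+ 2 <= V) ->
  0 <= l -> l ^+ 2 * V <= 1 ->
  (mu [set u | t <= `|f u - mean mu f|]%R <= (4 * expR (- (l * t)))%:E)%E.
Proof.
move=> bf hV l0 hl; pose g u := f u - mean mu f.
have bg : bmeas g by apply: bmeasB => //; exact: bmeas_cst.
have bNg : bmeas (fun u => - g u).
  by have := bmeasB (bmeas_cst 0) bg; congr bmeas; apply/funext => u; rewrite sub0r.
have g0 : mean mu g = 0 by rewrite meanB ?mean_cst ?subrr//; exact: bmeas_cst.
have Ng0 : mean mu (fun u => - g u) = 0.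
  transitivity (mean mu (fun u => (-1) * g u)); last by rewrite meanZ// g0 mulr0.
  by congr (mean _ _); apply/funext => u; rewrite mulN1r.
have gV p : \sum_(k < m) (g p.1 - g (resample k p)) ^+ 2 <= V.
  apply: le_trans (hV p); apply: ler_sum => k _.
  by rewrite (_ : g p.1 - g (resample k p) = f p.1 - f (resample k p))// /g; ring.
have NgV p : \sum_(k < m) (- g p.1 - - g (resample k p)) ^+ 2 <= V.
  apply: le_trans (gV p); apply: ler_sum => k _.
  by rewrite (_ : - g p.1 - - g (resample k p) = - (g p.1 - g (resample k p))) ?sqrrN//; ring.
have m1 := mgf_le2 bg gV g0 hl; have m2 := mgf_le2 bNg NgV Ng0 hl.
set A := [set u | _].
have mA : measurable A.
  rewrite /A -[X in measurable X]setTI.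
  have mN : measurable_fun setT (fun u => `|g u|) by apply: measurableT_comp => //; case: bg.
  have := measurable_fun_ler (measurable_cst t) mN.
  by move=> /(_ measurableT [set true] _); apply.
have bA : bmeas (\1_A : U -> R).
  split; first exact: measurable_indic.
  by exists 1 => u; rewrite indicE; case: (_ \in _); rewrite ?normr1 ?normr0.
have eA : (mu A = (mean mu \1_A)%:E)%E.
  rewrite /mean /Rintegral integral_indic// setIT fineK//.
  exact: fin_num_measure.
rewrite eA lee_fin expRN -[leRHS]/(4 / _) ler_pdivlMr ?expR_gt0// mulrC -meanZ//.
apply: (@le_trans _ _ (mgf g l + mgf (fun u => - g u) l)); last by lra.
have b1 : bmeas (fun u => expR (l * g u)) by apply: bmeas_expR; apply: bmeasM => //; exact: bmeas_cst.
have b2 : bmeas (fun u => expR (l * - g u)) by apply: bmeas_expR; apply: bmeasM => //; exact: bmeas_cst.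
rewrite /mgf -meanD//; apply: mean_le; [|exact: bmeasD|].
  by apply: bmeasM => //; exact: bmeas_cst.
move=> u; rewrite indicE; case: (boolP (u \in A)) => [|_]; last first.
  by rewrite mulr0 addr_ge0 ?expR_ge0.
rewrite inE /A /= -/(g u) mulr1 => hu.
have [g_ge0|g_lt0] := leP 0 (g u).
  rewrite -[leLHS]addr0 lerD ?expR_ge0// ler_expR ler_wpM2l//.
  by rewrite ger0_norm in hu.
rewrite -[leLHS]add0r lerD ?expR_ge0// ler_expR ler_wpM2l//.
by rewrite ltr0_norm in hu.
Qed.

End Resampling.

(** * The discrete torus *)

Section Torus.
Variables (d n : nat).

(** The torus of side n.+1. The side is positive, so the coordinates are residues
    and the torus is a finite commutative group, on which sums are invariant
    under translations. *)
Definition tor : finZmodType := 'cV['I_n.+1]_d.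

Definition red (x : Zd d) : tor := \col_i ((inZp 1 : 'I_n.+1) *~ x i 0).

Definition step (i : 'I_d) : tor := red (unitv i).

(** Representatives are taken in {1, ..., N}^d rather than in {0, ..., N - 1}^d,
    which explains the shift by one. *)
Definition rep (t : tor) : Zd d := \col_i (val (t i 0 - inZp 1)).+1%:Z.

Lemma redD x y : red (x + y) = red x + red y.
Proof. by apply/matrixP => i j; rewrite !mxE mulrzDr. Qed.

Lemma redN x : red (- x) = - red x.
Proof. by apply/matrixP => i j; rewrite !mxE mulrNz. Qed.

Lemma redB x y : red (x - y) = red x - red y.
Proof. by rewrite redD redN. Qed.

(** The class of 1 is a generator for every side, including side 1, where the
    residues do not form a nontrivial ring and 1 is not available. *)
Lemma inZp1_mulrn k : (inZp 1 : 'I_n.+1) *+ k = inZp k.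
Proof. by rewrite Zp_mulrn; apply: val_inj; rewrite /= modnMml mul1n. Qed.

Lemma redMn x : red (x *+ n.+1) = 0.
Proof.
apply/matrixP => i j; rewrite !mxE mulmxnE -mulr_natr mulrzA.
by rewrite natz -pmulrn Zp_mulrn; apply: val_inj; rewrite /= modnMl.
Qed.

Lemma rep_red t : red (rep t) = t.
Proof.
apply/matrixP => i j; rewrite ord1 !mxE -pmulrn mulrSr inZp1_mulrn valZpK.
by rewrite subrK.
Qed.

Lemma rep_QN t : rep t \in QN d n.+1.
Proof. by rewrite mem_QN; apply/forallP => i; rewrite mxE; exact: ltn_ord. Qed.

Lemma red_eqP x y : red x = red y -> exists k : Zd d, x = y + k *+ n.+1.
Proof.
move=> h; exists (\col_i divz (x i 0 - y i 0) n.+1).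
apply/matrixP => i j; rewrite ord1 !mxE mulmxnE mxE.
have h0 : (inZp 1 : 'I_n.+1) *~ (x i 0 - y i 0) = 0.
  by move/matrixP: h => /(_ i 0); rewrite !mxE mulrzBr => ->; rewrite subrr.
have hd : (n.+1 %| (x i 0 - y i 0)%R)%Z.
  move: h0; move: (x i 0 - y i 0) => [k|k].
    rewrite -pmulrn inZp1_mulrn => /(congr1 val) /= hk.
    by rewrite dvdzE /=; apply/eqP.
  rewrite NegzE mulrNz => /eqP; rewrite oppr_eq0 -pmulrn inZp1_mulrn => /eqP /(congr1 val) /= hk.
  by rewrite dvdzE abszN /=; apply/eqP.
by rewrite -mulr_natr natz divzK// addrC subrK.
Qed.

Lemma sum_QN (V : nmodType) (F : Zd d -> V) (G : tor -> V) :
  (forall x, F x = G (red x)) -> \sum_(x <- QN d n.+1) F x = \sum_t G t.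
Proof.
move=> FG; rewrite /QN big_map big_enum /=.
pose ones : tor := const_mx (inZp 1).
rewrite [RHS](reindex_inj (addIr ones)) /=; apply: eq_bigr => f _.
rewrite FG; congr G; apply/matrixP => i j.
by rewrite ord1 !mxE -pmulrn mulrSr inZp1_mulrn valZpK.
Qed.

(** The shifts that preserve F form a group that contains the generators. *)
Lemma periodic_shift (A : Type) (M : nat) (F : Zd d -> A) :
  (forall x i, F (x + unitv i *+ M) = F x) -> forall x k, F (x + k *+ M) = F x.
Proof.
move=> per; pose S (k : Zd d) := forall x, F (x + k *+ M) = F x.
have S0 : S 0 by move=> x; rewrite mul0rn addr0.
have SD k l : S k -> S l -> S (k + l) by move=> hk hl x; rewrite mulrnDl addrA hl hk.
have SN k : S k -> S (- k) by move=> hk x; rewrite -(hk (x + - k *+ M)) mulNrn subrK.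
have SZ i z : S (unitv i *~ z).
  elim/int_rec: z => [|z IH|z IH]; first by rewrite mulr0z.
    have -> : Posz z.+1 = z%:Z + 1 by lia.
    by rewrite mulrzDr; apply: SD => // x; exact: per.
  have -> : - Posz z.+1 = - z%:Z - 1 by lia.
  by rewrite mulrzBr; apply: SD => //; apply: SN => x; exact: per.
move=> x k; have -> : k = \sum_i unitv i *~ k i 0.
  apply/matrixP => i j; rewrite ord1 summxE (bigD1 i)//= big1 => [|l li].
    by rewrite addr0 -scaler_int !mxE !eqxx mulr1 intz.
  by rewrite -scaler_int !mxE eq_sym (negbTE li) mulr0.
by move: x; apply: (big_ind S) => // i _; exact: SZ.
Qed.

Lemma periodic_red (A : Type) (F : Zd d -> A) :
  (forall x i, F (x + unitv i *+ n.+1) = F x) -> forall x, F x = F (rep (red x)).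
Proof.
move=> per x; have [k hk] := red_eqP (esym (rep_red (red x))).
by rewrite {1}hk (periodic_shift per).
Qed.

End Torus.

(** * Flows on the torus and the corrector equation *)

Section Flows.
Variables (R : realType) (d n : nat).
Notation T := (tor d n).
Implicit Types (b g : T * 'I_d -> R) (y : T -> R) (chi : T -> 'cV[R]_d).

(** Flows are indexed by the edges (t, i) from t to t + step i, so the second
    term is the flow that enters t along direction i. *)
Definition div g (t : T) : R := \sum_i (g (t, i) - g (t - step n i, i)).

Definition grad y (e : T * 'I_d) : R := y (e.1 + step n e.2) - y e.1.

Definition tmass b (t : T) : R := \sum_i (b (t, i) + b (t - step n i, i)).

(** The increment of x_j + chi_j along e; the function x_j itself is not periodic,
    but its increments are. *)
Definition slope chi (j : 'I_d) (e : T * 'I_d) : R :=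
  (e.2 == j)%:R + grad (fun t => chi t j 0) e.

Lemma sum_edges (F : T * 'I_d -> R) : \sum_e F e = \sum_i \sum_t F (t, i).
Proof.
rewrite exchange_big pair_bigA /=.
by apply: eq_bigr => -[].
Qed.

Lemma sum_shift (F : T -> R) s : \sum_t F (t + s) = \sum_t F t.
Proof. by rewrite [RHS](reindex_inj (addIr s)). Qed.

Lemma sum_by_parts y g : \sum_t y t * div g t = - \sum_e g e * grad y e.
Proof.
rewrite sum_edges.
under eq_bigr do rewrite /div mulr_sumr.
rewrite exchange_big -sumrN; apply: eq_bigr => i _ /=.
under eq_bigr do rewrite mulrBr.
rewrite sumrB -(sum_shift (fun t => y t * g (t - step n i, i)) (step n i)).
rewrite -sumrB -sumrN; apply: eq_bigr => t _; rewrite /grad /= addrK; ring.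
Qed.

Lemma sum_div g : \sum_t div g t = 0.
Proof.
transitivity (\sum_t 1 * div g t); first by apply: eq_bigr => t _; rewrite mul1r.
rewrite (sum_by_parts (fun=> 1)) big1 ?oppr0// => e _.
by rewrite /grad subrr mulr0.
Qed.

Lemma sum_tmass b : \sum_t tmass b t = 2 * \sum_e b e.
Proof.
rewrite sum_edges /tmass exchange_big mulr_sumr; apply: eq_bigr => i _ /=.
by rewrite big_split /= (sum_shift (fun t => b (t, i))) mulrDl mul1r.
Qed.

(** The corrector equation determines chi only up to a constant. Adding the mean
    of y with respect to the vertex masses turns the operator into an invertible
    square system that enforces the normalization of the corrector as well. *)
Definition kop b y (t : T) : R :=
  - div (fun e => b e * grad y e) t + \sum_z tmass b z * y z.

Definition kern b (t z : T) : R :=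
  - \sum_i (b (t, i) * ((z == t + step n i)%:R - (z == t)%:R)
      - b (t - step n i, i) * ((z == t)%:R - (z == t - step n i)%:R)) + tmass b z.

Lemma sum_pick (t : T) y : \sum_z (z == t)%:R * y z = y t.
Proof.
rewrite (bigD1 t)//= eqxx mul1r big1 ?addr0// => z /negbTE ->.
by rewrite mul0r.
Qed.

Lemma kernE b y t : \sum_z kern b t z * y z = kop b y t.
Proof.
rewrite /kern /kop; under eq_bigr do rewrite mulrDl.
rewrite big_split /=; congr (_ + _).
under eq_bigr do rewrite mulNr mulr_suml.
rewrite sumrN exchange_big /div; congr (- _); apply: eq_bigr => i _ /=.
rewrite /grad /= subrK.
under eq_bigr do rewrite mulrBl -!mulrA !mulrBl.
by rewrite sumrB -!mulr_sumr !sumrB !sum_pick.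
Qed.

(** Functions are encoded as row vectors, hence the transposed kernel. *)
Definition kmx b : 'M[R]_#|T| := \matrix_(p, q) kern b (enum_val q) (enum_val p).

Definition row_of y : 'rV[R]_#|T| := \row_p y (enum_val p).

Lemma sum_enum_val (F : T -> R) : \sum_(p < #|T|) F (enum_val p) = \sum_t F t.
Proof.
by rewrite [RHS](reindex _ (onW_bij _ (@enum_val_bij T))).
Qed.

Lemma row_of_kmx b y : row_of y *m kmx b = row_of (kop b y).
Proof.
apply/rowP => q; rewrite !mxE -kernE -sum_enum_val.
by apply: eq_bigr => p _; rewrite !mxE mulrC.
Qed.

Lemma row_of_inj y y' : row_of y = row_of y' -> y =1 y'.
Proof. by move=> /rowP h t; have := h (enum_rank t); rewrite !mxE enum_rankK. Qed.

Lemma sum_kop b y : \sum_t kop b y t = (\sum_z tmass b z * y z) *+ #|T|.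
Proof.
by rewrite big_split /= sumrN sum_div oppr0 add0r sumr_const.
Qed.

Lemma card_tor_neq0 : #|T|%:R != 0 :> R.
Proof. by rewrite pnatr_eq0 -lt0n; apply/card_gt0P; exists 0. Qed.

(** A divergence has total sum 0 on the torus, so summing over all vertices
    isolates the mean term. *)
Lemma kop_eq0 b y : (forall t, kop b y t = 0) ->
  \sum_z tmass b z * y z = 0 /\ forall t, div (fun e => b e * grad y e) t = 0.
Proof.
move=> h; have h0 : \sum_z tmass b z * y z = 0.
  have := sum_kop b y; rewrite big1// => /esym/eqP.
  by rewrite -mulr_natr mulf_eq0 (negbTE card_tor_neq0) orbF => /eqP.
by split=> // t; have := h t; rewrite /kop h0 addr0 => /eqP; rewrite oppr_eq0 => /eqP.
Qed.

Definition rhs b (j : 'I_d) (t : T) : R := b (t, j) - b (t - step n j, j).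

(** This number is nonzero exactly when the corrector equation has a unique
    solution, for conductances of arbitrary sign (correctorE). *)
Definition nondeg b : R := (\prod_t tmass b t) * \det (kmx b).

(** Cramer's rule, written with the adjugate so that every entry is visibly a
    measurable function of the conductances. *)
Definition chi_of b (t : T) : 'cV[R]_d :=
  \col_j if nondeg b == 0 then 0 else
    \sum_p rhs b j (enum_val p) * ((\det (kmx b))^-1 * (\adj (kmx b)) p (enum_rank t)).

Lemma nondegP b : nondeg b != 0 ->
  (forall t, tmass b t != 0) /\ kmx b \in unitmx.
Proof.
rewrite mulf_eq0 negb_or => /andP[/prodf_neq0 h hdet].
by split=> [t|]; [exact: h | rewrite unitmxE unitfE].
Qed.

Lemma div_slope b chi j t :
  div (fun e => b e * slope chi j e) t =
  rhs b j t + div (fun e => b e * grad (fun t => chi t j 0) e) t.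
Proof.
rewrite /div /slope /=.
rewrite (eq_bigr (fun i => (b (t, i) - b (t - step n i, i)) * (i == j)%:R +
  (b (t, i) * grad (fun t => chi t j 0) (t, i) -
   b (t - step n i, i) * grad (fun t => chi t j 0) (t - step n i, i)))); last first.
  by move=> i _; ring.
rewrite big_split /=; congr (_ + _).
rewrite (bigD1 j)//= eqxx mulr1 big1 ?addr0// => i /negbTE ->.
by rewrite mulr0.
Qed.

Lemma sum_rhs b j : \sum_t rhs b j t = 0.
Proof. by rewrite sumrB (sum_shift (fun t => b (t, j))) subrr. Qed.

Lemma solves_kop b chi j :
  \sum_t tmass b t * chi t j 0 = 0 ->
  (forall t, div (fun e => b e * slope chi j e) t = 0) ->
  forall t, kop b (fun t => chi t j 0) t = rhs b j t.
Proof.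
move=> h0 h t; rewrite /kop h0 addr0; have := h t; rewrite div_slope.
by move/eqP; rewrite addrC addr_eq0 => /eqP ->; rewrite opprK.
Qed.

Lemma kop_solves b chi j :
  (forall t, kop b (fun t => chi t j 0) t = rhs b j t) ->
  \sum_t tmass b t * chi t j 0 = 0 /\
  (forall t, div (fun e => b e * slope chi j e) t = 0).
Proof.
move=> h; have h0 : \sum_t tmass b t * chi t j 0 = 0.
  have := sum_kop b (fun t => chi t j 0).
  rewrite (eq_bigr _ (fun t _ => h t)) sum_rhs => /esym/eqP.
  by rewrite -mulr_natr mulf_eq0 (negbTE card_tor_neq0) orbF => /eqP.
split=> // t; rewrite div_slope -h /kop h0 addr0; exact: addNr.
Qed.

Lemma row_of_chi b j : nondeg b != 0 ->
  row_of (fun t => chi_of b t j 0) = row_of (rhs b j) *m invmx (kmx b).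
Proof.
move=> hb; have [_ hK] := nondegP hb.
apply/rowP => p; rewrite !mxE (negbTE hb); apply: eq_bigr => q _.
by rewrite /invmx hK !mxE enum_valK.
Qed.

Lemma chi_of_solves b j : nondeg b != 0 ->
  \sum_t tmass b t * chi_of b t j 0 = 0 /\
  (forall t, div (fun e => b e * slope (chi_of b) j e) t = 0).
Proof.
move=> hb; apply: kop_solves; apply: row_of_inj.
by rewrite -row_of_kmx row_of_chi// mulmxKV//; case: (nondegP hb).
Qed.

Lemma solves_chi_of b chi j : nondeg b != 0 ->
  \sum_t tmass b t * chi t j 0 = 0 ->
  (forall t, div (fun e => b e * slope chi j e) t = 0) ->
  forall t, chi t j 0 = chi_of b t j 0.
Proof.
move=> hb h0 h; apply: (@row_of_inj (fun t => chi t j 0) (fun t => chi_of b t j 0)).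
rewrite row_of_chi//; have [_ hK] := nondegP hb.
rewrite -[LHS](mulmxK hK) row_of_kmx; congr (_ *m _).
by congr row_of; apply/funext; exact: solves_kop.
Qed.

Lemma singular_kop b : kmx b \notin unitmx ->
  exists2 y, (exists t, y t != 0) & forall t, kop b y t = 0.
Proof.
rewrite -row_free_unit -kermx_eq0 => /rowV0Pn[v /sub_kermxP hv v0].
pose y t := v 0 (enum_rank t).
have vy : v = row_of y by apply/rowP => p; rewrite mxE /y enum_valK.
exists y.
  move: v0; apply: contraNP => /forallNP hy; apply/eqP/rowP => p.
  by rewrite vy !mxE; have /negP := hy (enum_val p); rewrite negbK => /eqP.
by apply: row_of_inj; rewrite -row_of_kmx -vy hv; apply/rowP => p; rewrite !mxE.
Qed.

(** A function with zero gradient pulls back to a function on the lattice that is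
    periodic with period 1. *)
Lemma grad_eq0 y : (forall e, grad y e = 0) -> forall t t', y t = y t'.
Proof.
move=> h; have per x i : y (red n (x + unitv i *+ 1)) = y (red n x).
  have := h (red n x, i); rewrite /grad /= => /eqP; rewrite subr_eq0 => /eqP <-.
  by rewrite mulr1n redD.
move=> t t'; have hs := @periodic_shift d R 1 (fun x => y (red n x)) per 0.
by rewrite -(rep_red t) -(rep_red t') -[rep t]add0r -[rep t']add0r
  -[rep t]mulr1n -[rep t']mulr1n !hs.
Qed.

Lemma energy_eq0 b y : (forall e, 0 < b e) ->
  (forall t, div (fun e => b e * grad y e) t = 0) -> forall e, grad y e = 0.
Proof.
move=> b0 h e; have : \sum_e b e * grad y e ^+ 2 = 0.
  transitivity (- \sum_t y t * div (fun e => b e * grad y e) t).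
    by rewrite sum_by_parts opprK; apply: eq_bigr => f _; rewrite expr2 mulrA.
  by rewrite big1 ?oppr0// => t _; rewrite h mulr0.
move/eqP; rewrite psumr_eq0 => [|f _]; last by rewrite mulr_ge0 ?sqr_ge0// ltW.
move/allP/(_ e (mem_index_enum _)); rewrite /= mulf_eq0 sqrf_eq0.
by rewrite gt_eqF//= => /eqP.
Qed.

Lemma tmass_gt0 b t : (0 < d)%N -> (forall e, 0 < b e) -> 0 < tmass b t.
Proof.
move=> hd b0; rewrite /tmass (bigD1 (Ordinal hd))//= ltr_pwDl ?addr_gt0//.
by apply: sumr_ge0 => i _; rewrite addr_ge0// ltW.
Qed.

(** A function in the kernel has zero energy, hence is constant, and its mean with
    respect to the positive vertex masses vanishes. *)
Lemma elliptic_nondeg b : (0 < d)%N -> (forall e, 0 < b e) -> nondeg b != 0.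
Proof.
move=> hd b0; rewrite mulf_neq0//.
  by apply/prodf_neq0 => t _; rewrite gt_eqF// tmass_gt0.
rewrite -unitfE -unitmxE; apply/negPn/negP => /singular_kop[y [t yt] hy].
have [h0 h1] := kop_eq0 hy; have cst := grad_eq0 (energy_eq0 b0 h1).
move: h0; rewrite (eq_bigr (fun z => tmass b z * y t)); last first.
  by move=> z _; rewrite (cst z t).
rewrite -mulr_suml => /eqP; rewrite mulf_eq0 (negbTE yt) orbF gt_eqF//.
rewrite (bigD1 t)//= ltr_pwDl ?tmass_gt0//.
by apply: sumr_ge0 => z _; rewrite ltW// tmass_gt0.
Qed.

End Flows.

(** * From the periodized lattice to the torus *)

Section Periodization.
Variables (R : realType) (d n : nat).
Notation T := (tor d n).
Notation N := n.+1.
Implicit Types (a : edge d -> R) (x y k : Zd d).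

Lemma sum_nbrs (V : nmodType) (F : Zd d -> V) x :
  \sum_(y <- nbrs x) F y = \sum_i (F (x + unitv i) + F (x - unitv i)).
Proof.
rewrite /nbrs big_cat !big_map big_split /=; congr (_ + _); exact: big_enum.
Qed.

Lemma perpair_shift x y k :
  perpair N (x + k *+ N) (y + k *+ N) = perpair N x y.
Proof.
have e : pershift N (x + k *+ N) (y + k *+ N) = pershift N x y + k.
  apply/matrixP => i j; rewrite ord1 !mxE !mulmxnE !pmulrn !mulrzz.
  have -> : Num.max (x i 0 + k i 0 * N) (y i 0 + k i 0 * N) - 1 =
      k i 0 * N + (Num.max (x i 0) (y i 0) - 1).
    by rewrite -addr_maxl addrAC addrC.
  by rewrite divzMDl// addrC.
rewrite /perpair e mulrnDl; congr (_, _); rewrite opprD addrACA subrr addr0//.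
Qed.

Lemma pcond_shift a x y k : pcond N a (x + k *+ N) (y + k *+ N) = pcond N a x y.
Proof. by rewrite /pcond perpair_shift. Qed.

Lemma pcondC a x y : pcond N a x y = pcond N a y x.
Proof.
have e : pershift N x y = pershift N y x.
  by apply/matrixP => i j; rewrite !mxE maxC.
by rewrite /pcond /perpair /= e condC.
Qed.

(** The conductances of the torus: the periodized conductance of the edge that
    leaves the representative of t in direction i. *)
Definition envt a (e : T * 'I_d) : R := pcond N a (rep e.1) (rep e.1 + unitv e.2).

Lemma pcond_up a x i : pcond N a x (x + unitv i) = envt a (red n x, i).
Proof.
have [k hk] := red_eqP (esym (rep_red (red n x))).
by rewrite /envt /= {1 2}hk addrAC pcond_shift.
Qed.

Lemma pcond_down a x i : pcond N a x (x - unitv i) = envt a (red n x - step n i, i).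
Proof.
by rewrite pcondC -{2}(subrK (unitv i) x) pcond_up redB.
Qed.

Lemma pmassE a x : pmass N a x = tmass (envt a) (red n x).
Proof.
by rewrite /pmass sum_nbrs; apply: eq_bigr => i _; rewrite pcond_up pcond_down.
Qed.

Lemma emb_unitv (i j : 'I_d) : emb R (unitv i) j 0 = (i == j)%:R.
Proof. by rewrite !mxE eqxx andbT eq_sym; case: (_ == _). Qed.

Lemma embD x y : emb R (x + y) = emb R x + emb R y.
Proof. by apply/matrixP => i j; rewrite !mxE intrD. Qed.

Definition position (chi : T -> 'cV[R]_d) x : 'cV[R]_d := emb R x + chi (red n x).

Lemma position_up chi x i j :
  position chi (x + unitv i) j 0 - position chi x j 0 = slope chi j (red n x, i).
Proof.
rewrite /slope /grad /= mxE embD redD [in X in X + _ - _]mxE emb_unitv.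
by rewrite [position _ _ _ _]mxE; ring.
Qed.

Lemma position_down chi x i j :
  position chi (x - unitv i) j 0 - position chi x j 0 =
  - slope chi j (red n x - step n i, i).
Proof.
by rewrite -redB -position_up subrK opprB.
Qed.

Lemma mass_Hop a (u : Zd d -> 'cV[R]_d) x : pmass N a x != 0 ->
  pmass N a x *: Hop N a u x = \sum_(y <- nbrs x) pcond N a x y *: (u x - u y).
Proof.
move=> h; rewrite /Hop scalerBr scaler_sumr.
under [RHS]eq_bigr do rewrite scalerBr.
rewrite sumrB -scaler_suml -/(pmass N a x); congr (_ - _).
by apply: eq_bigr => y _; rewrite scalerA /ptrans mulrCA divff// mulr1.
Qed.

(** After multiplication by the vertex mass, the generator applied to the harmonic
    coordinates is the divergence of their flow. *)
Lemma mass_Hop_div a chi x j : pmass N a x != 0 ->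
  (pmass N a x *: Hop N a (position chi) x) j 0 =
  - div (fun e => envt a e * slope chi j e) (red n x).
Proof.
move=> h; rewrite mass_Hop// summxE sum_nbrs /div -sumrN; apply: eq_bigr => i _.
rewrite mxE (_ : (position chi x - position chi (x + unitv i)) j 0 =
  - slope chi j (red n x, i)); last by rewrite -position_up !mxE; ring.
rewrite mxE (_ : (position chi x - position chi (x - unitv i)) j 0 =
   slope chi j (red n x - step n i, i)); last first.
  by rewrite -[RHS]opprK -position_down !mxE; ring.
by rewrite pcond_up pcond_down; ring.
Qed.

Lemma HopD a (u v : Zd d -> 'cV[R]_d) x :
  Hop N a (fun x => u x + v x) x = Hop N a u x + Hop N a v x.
Proof.
rewrite /Hop; under eq_bigr do rewrite scalerDr.
by rewrite big_split /= opprD addrACA.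
Qed.

Lemma Hop_mass0 a (u : Zd d -> 'cV[R]_d) x : pmass N a x = 0 -> Hop N a u x = u x.
Proof.
move=> h; rewrite /Hop big1 ?subr0// => y _.
by rewrite /ptrans h invr0 mulr0 scale0r.
Qed.

(** At a vertex of mass 0 all transition probabilities are 0 by the convention
    x / 0 = 0, and the equation reads chi = - x there. This contradicts the
    periodicity of chi. *)
Lemma corrector_mass a chi : (0 < d)%N -> is_corrector N a chi ->
  forall t : T, tmass (envt a) t != 0.
Proof.
move=> hd [per _ eqn] t; apply/eqP => h.
have hm (x : Zd d) : red n x = t -> pmass N a x = 0 by move=> e; rewrite pmassE e.
pose i := Ordinal hd.
have h1 := eqn (rep t); rewrite !Hop_mass0 in h1; try exact/hm/rep_red.
have hr : red n (rep t + unitv i *+ N) = t by rewrite redD redMn addr0 rep_red.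
have := eqn (rep t + unitv i *+ N); rewrite !Hop_mass0; try exact/hm.
rewrite per h1 => /(congr1 -%R); rewrite !opprK embD => /eqP.
rewrite -subr_eq0 opprD addrA subrr sub0r oppr_eq0 => /eqP /matrixP /(_ i 0).
rewrite !mxE mulmxnE !mxE !eqxx /= => /eqP.
by rewrite intr_eq0 pnatr_eq0.
Qed.

Lemma is_correctorP a C : (0 < d)%N ->
  is_corrector N a C <->
  exists2 chi : T -> 'cV[R]_d, C = chi \o @red d n &
    (forall t, tmass (envt a) t != 0) /\
    forall j, \sum_t tmass (envt a) t * chi t j 0 = 0 /\
      forall t, div (fun e => envt a e * slope chi j e) t = 0.
Proof.
move=> hd; have summ (chi : T -> 'cV[R]_d) (j : 'I_d) :
    (\sum_(x <- QN d N) pmass N a x *: chi (red n x)) j 0 =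
    \sum_t tmass (envt a) t * chi t j 0.
  rewrite summxE; apply: (sum_QN (G := fun t => tmass (envt a) t * chi t j 0)) => x.
  by rewrite mxE pmassE.
split=> [h|[chi -> [hm h]]].
  have hm := corrector_mass hd h; case: h => per h0 eqn.
  have hC : C = (fun t => C (rep t)) \o @red d n.
    by apply/funext => x; rewrite /= {1}(periodic_red per x).
  exists (fun t => C (rep t)) => //; split=> // j; split.
    rewrite -summ; move: h0 => /matrixP /(_ j 0); rewrite [RHS]mxE => <-.
    by rewrite !summxE; apply: eq_bigr => x _; rewrite -(periodic_red per x).
  move=> t; have hx : pmass N a (rep t) != 0 by rewrite pmassE.
  have := mass_Hop_div (fun t => C (rep t)) j hx; rewrite rep_red.
  have -> : position (fun t => C (rep t)) = (fun x => emb R x + C x).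
    by apply/funext => x; rewrite /position -(periodic_red per x).
  rewrite HopD eqn subrr scaler0 mxE => /esym/eqP.
  by rewrite oppr_eq0 => /eqP.
split=> [x i||x].
- by rewrite /= redD redMn addr0.
- by apply/matrixP => j k; rewrite ord1 summ mxE; case: (h j).
- have hx : pmass N a x != 0 by rewrite pmassE.
  apply/eqP; rewrite -addr_eq0 addrC -HopD; apply/eqP.
  apply: (scalerI hx); rewrite scaler0; apply/matrixP => j k; rewrite ord1.
  rewrite (mass_Hop_div chi j hx) mxE; case: (h j) => _ ->; exact: oppr0.
Qed.

(** If the system is singular while all masses are nonzero, a kernel vector can
    be added to any corrector, so there is no unique corrector and the default
    value 0 is taken on both sides. *)
Lemma correctorE a : (0 < d)%N ->
  corrector N a = chi_of (envt a) \o @red d n.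
Proof.
move=> hd; have [h0|h0] := eqVneq (nondeg (envt a)) 0; last first.
  have [hm _] := nondegP h0.
  apply: xget_unique.
    split; first by apply/(is_correctorP _ _ hd); exists (chi_of (envt a)) => //; split => // j; exact: chi_of_solves.
    move=> C /(is_correctorP _ _ hd)[chi -> [_ h]]; apply/funext => x /=.
    apply/matrixP => j k; rewrite ord1; apply/esym.
    by apply: solves_chi_of => //; case: (h j).
  move=> C [_ hC]; apply: hC; apply/(is_correctorP _ _ hd).
  by exists (chi_of (envt a)) => //; split => // j; exact: chi_of_solves.
have -> : chi_of (envt a) \o @red d n = (fun=> 0).
  by apply/funext => x; apply/matrixP => j k; rewrite !mxE h0 eqxx.
apply: xgetPN => C [/(is_correctorP _ _ hd)[chi Cchi [hm h]] huniq].
have hK : kmx (envt a) \notin unitmx.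
  move: h0 => /eqP; rewrite mulf_eq0 unitmxE unitfE negbK => /orP[|//].
  suff : \prod_t tmass (envt a) t != 0 by move/negbTE ->.
  by apply/prodf_neq0 => t _; exact: hm.
have [y [t yt] hy] := singular_kop hK; have [y0 ydiv] := kop_eq0 hy.
(* The kernel vector y is added to all coordinates of the corrector. *)
pose chi' t := chi t + const_mx (y t).
suff : is_corrector N a (chi' \o @red d n).
  move/huniq; rewrite Cchi => /(congr1 (fun f => f (rep t))) /=.
  rewrite rep_red /chi' => /eqP; rewrite eq_sym addrC -subr_eq0 addrK => /eqP.
  by move/matrixP/(_ (Ordinal hd) 0); rewrite !mxE => /eqP; rewrite (negbTE yt).
apply/(is_correctorP _ _ hd); exists chi' => //; split=> // j.
have [h1 h2] := h j; split.
  transitivity (\sum_t tmass (envt a) t * chi t j 0 + \sum_t tmass (envt a) t * y t).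
    by rewrite -big_split; apply: eq_bigr => z _; rewrite /chi' !mxE mulrDr.
  by rewrite h1 y0 addr0.
move=> z; transitivity (div (fun e => envt a e * slope chi j e) z +
    div (fun e => envt a e * grad y e) z); last by rewrite h2 ydiv addr0.
rewrite -big_split; apply: eq_bigr => i _.
by rewrite /slope /grad /chi' /= !mxE; ring.
Qed.

(** The diffusion matrix as a function on the torus, in the form that is valid and
    measurable for arbitrary conductances; see tdiffE for the elliptic ones. *)
Definition tdiff (b : T * 'I_d -> R) (j k : 'I_d) : R :=
  \sum_t tmass b t / (\sum_z tmass b z) *
    \sum_i (b (t, i) / tmass b t * (slope (chi_of b) j (t, i) * slope (chi_of b) k (t, i))
      + b (t - step n i, i) / tmass b t *
        (slope (chi_of b) j (t - step n i, i) * slope (chi_of b) k (t - step n i, i))).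

Lemma diffusionE a (j k : 'I_d) : (0 < d)%N -> diffusion N a j k = tdiff (envt a) j k.
Proof.
move=> hd; rewrite /diffusion summxE.
pose G t := tmass (envt a) t / (\sum_z tmass (envt a) z) *
    \sum_i (envt a (t, i) / tmass (envt a) t *
       (slope (chi_of (envt a)) j (t, i) * slope (chi_of (envt a)) k (t, i))
      + envt a (t - step n i, i) / tmass (envt a) t *
        (slope (chi_of (envt a)) j (t - step n i, i) * slope (chi_of (envt a)) k (t - step n i, i))).
apply: (@sum_QN d n R _ G) => x; rewrite mxE summxE /G; congr (_ * _).
  by rewrite /pinv_meas pmassE (sum_QN (pmassE a)).
have hv y l : vN N a y l 0 = position (chi_of (envt a)) y l 0.
  by rewrite /vN correctorE.
have hprod y : (ptrans N a x y *: ((vN N a y - vN N a x) *m (vN N a y - vN N a x)^T)) j k =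
    pcond N a x y / pmass N a x *
    ((position (chi_of (envt a)) y j 0 - position (chi_of (envt a)) x j 0) *
     (position (chi_of (envt a)) y k 0 - position (chi_of (envt a)) x k 0)).
  have hv2 l : (vN N a y - vN N a x) l 0 =
      position (chi_of (envt a)) y l 0 - position (chi_of (envt a)) x l 0.
    by rewrite -!hv !mxE.
  rewrite mxE /ptrans; congr (_ * _); rewrite mxE big_ord1.
  by rewrite -!hv2; congr (_ * _); rewrite mxE.
rewrite (eq_bigr _ (fun y _ => hprod y)) sum_nbrs; apply: eq_bigr => i _.
by rewrite !position_up !position_down mulrNN pcond_up pcond_down pmassE.
Qed.

End Periodization.

(** * Energy estimates and the influence of one edge *)

Section Energy.
Variables (R : realType) (d n : nat) (kappa : R).
Hypotheses (hd : (0 < d)%N) (hkappa : 1 <= kappa).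
Notation T := (tor d n).
Implicit Types (b : T * 'I_d -> R).

Definition elliptic b : Prop := forall e, kappa^-1 <= b e <= kappa.

Let k0 : 0 < kappa. Proof. exact: lt_le_trans ltr01 hkappa. Qed.

Definition cslope b j e : R := slope (chi_of b) j e.

Definition energy b j k : R := \sum_e b e * (cslope b j e * cslope b k e).

Lemma elliptic_gt0 b e : elliptic b -> 0 < b e.
Proof. by move=> /(_ e)/andP[h _]; apply: lt_le_trans h; rewrite invr_gt0. Qed.

Lemma tdiffE b j k : elliptic b -> tdiff b j k = energy b j k / \sum_e b e.
Proof.
move=> hb; have b0 e := elliptic_gt0 e hb.
have m0 t : tmass b t != 0 by rewrite gt_eqF// tmass_gt0.
rewrite /tdiff /energy; set S := \sum_z tmass b z.
have hS : S != 0.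
  rewrite /S (bigD1 0)//= gt_eqF// ltr_pwDl ?(tmass_gt0 _ hd b0)//.
  by apply: sumr_ge0 => z _; rewrite ltW// tmass_gt0.
pose F e := b e * (cslope b j e * cslope b k e).
transitivity (S^-1 * \sum_t tmass F t).
  rewrite mulr_sumr; apply: eq_bigr => t _.
  rewrite /tmass mulr_sumr mulr_sumr; apply: eq_bigr => i _; rewrite /F /cslope.
  rewrite -/(tmass b t); field.
  by rewrite m0 hS.
rewrite sum_tmass /S sum_tmass invfM mulrACA mulVf// mul1r mulrC.
by [].
Qed.

(** The flow of a harmonic coordinate is divergence-free. *)
Lemma flow_orthogonal b j y : elliptic b ->
  \sum_e b e * cslope b j e * grad y e = 0.
Proof.
move=> hb; have b0 e := elliptic_gt0 e hb.
have := sum_by_parts y (fun e => b e * cslope b j e).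
have [_ h] := chi_of_solves j (elliptic_nondeg hd b0).
by rewrite big1 => [/esym/eqP|t _]; [rewrite oppr_eq0 => /eqP | rewrite h mulr0].
Qed.

(** The harmonic coordinates of any two environments and the affine coordinate
    differ by periodic functions, whose gradients the flow does not see. *)
Lemma flow_test b b' j k : elliptic b ->
  \sum_e b e * cslope b j e * cslope b' k e = \sum_e b e * cslope b j e * (e.2 == k)%:R.
Proof.
move=> hb; have h := flow_orthogonal j (fun t => chi_of b' t k 0) hb.
rewrite -[RHS]addr0 -[X in _ = _ + X]h -big_split.
by apply: eq_bigr => e _ /=; rewrite -mulrDr.
Qed.

Lemma energy_sym b j k : energy b j k = energy b k j.
Proof. by apply: eq_bigr => e _; rewrite [cslope b j e * _]mulrC. Qed.

(** The harmonic coordinate has less energy than the affine one. *)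
Lemma energy_le b j : elliptic b -> energy b j j <= kappa * #|{: T * 'I_d}|%:R.
Proof.
move=> hb; have b0 e := elliptic_gt0 e hb.
have e1 : energy b j j = \sum_e b e * cslope b j e * (e.2 == j)%:R.
  by rewrite -(flow_test b j j hb); apply: eq_bigr => e _; rewrite mulrA.
have e2 : \sum_e b e * cslope b j e * (e.2 == j)%:R <=
   2^-1 * energy b j j + 2^-1 * (kappa * #|{: T * 'I_d}|%:R).
  rewrite mulr_natr -sumr_const !mulr_sumr -big_split; apply: ler_sum => e _ /=.
  have /andP[_ hk] := hb e.
  have h1 : (e.2 == j)%:R ^+ 2 * b e <= kappa :> R.
    by case: (_ == _); rewrite ?expr0n ?expr1n ?mul0r ?mul1r// ltW.
  have := mulr_ge0 (ltW (b0 e)) (sqr_ge0 (cslope b j e - (e.2 == j)%:R)).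
  move: ((e.2 == j)%:R : R) h1 => c h1; nra.
lra.
Qed.

Lemma sum_sqr_cslope b j : elliptic b ->
  \sum_e cslope b j e ^+ 2 <= kappa ^+ 2 * #|{: T * 'I_d}|%:R.
Proof.
move=> hb; rewrite expr2 -mulrA -ler_pdivrMl//.
apply: le_trans (energy_le j hb); rewrite mulr_sumr; apply: ler_sum => e _.
by rewrite -expr2 ler_wpM2r ?sqr_ge0//; case/andP: (hb e).
Qed.

Lemma energy_norm_le b j k : elliptic b -> `|energy b j k| <= kappa * #|{: T * 'I_d}|%:R.
Proof.
move=> hb; apply: (@le_trans _ _ (2^-1 * energy b j j + 2^-1 * energy b k k)).
  apply: le_trans (ler_norm_sum _ _ _) _; rewrite !mulr_sumr -big_split.
  apply: ler_sum => e _ /=; have b0 := elliptic_gt0 e hb.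
  rewrite normrM (gtr0_norm b0).
  rewrite [leRHS](_ : _ = b e * (2^-1 * (cslope b j e ^+ 2 + cslope b k e ^+ 2))); last by ring.
  rewrite ler_wpM2l// ?(ltW b0)// ler_norml.
  have := sqr_ge0 (cslope b j e - cslope b k e); have := sqr_ge0 (cslope b j e + cslope b k e).
  by move=> h1 h2; apply/andP; split; nra.
have := energy_le j hb; have := energy_le k hb; lra.
Qed.

Lemma conductance_sum_ge b : elliptic b -> kappa^-1 * #|{: T * 'I_d}|%:R <= \sum_e b e.
Proof.
move=> hb; rewrite mulr_natr -sumr_const; apply: ler_sum => e _.
by case/andP: (hb e).
Qed.

Section OneEdge.
Variables (b b' : T * 'I_d -> R) (e0 : T * 'I_d).
Hypotheses (hb : elliptic b) (hb' : elliptic b').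
Hypothesis hdiff : forall e, e != e0 -> b e = b' e.

Lemma sum_one_edge (F : T * 'I_d -> R) :
  \sum_e b e * F e - \sum_e b' e * F e = (b e0 - b' e0) * F e0.
Proof.
rewrite -sumrB (bigD1 e0)//= big1 ?addr0 -?mulrBl// => e he.
by rewrite hdiff// subrr.
Qed.

Lemma edge_diff_le : `|b e0 - b' e0| <= kappa.
Proof.
have /andP[h1 h2] := hb e0; have /andP[h3 h4] := hb' e0.
have : 0 < kappa^-1 by rewrite invr_gt0.
by move=> h5; rewrite ler_norml; apply/andP; split; lra.
Qed.

(** By flow_test both energies can be evaluated on the mixed product
    s_j(b) s_k(b'), so they differ at the modified edge only. *)
Lemma energy_one_edge j k :
  energy b j k - energy b' j k = (b e0 - b' e0) * (cslope b j e0 * cslope b' k e0).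
Proof.
rewrite -(sum_one_edge (fun e => cslope b j e * cslope b' k e)); congr (_ - _).
  transitivity (\sum_e b e * cslope b j e * cslope b k e).
    by apply: eq_bigr => e _; rewrite mulrA.
  rewrite (flow_test b j k hb) -(flow_test b' j k hb).
  by apply: eq_bigr => e _; rewrite mulrA.
rewrite energy_sym; transitivity (\sum_e b' e * cslope b' k e * cslope b' j e).
  by apply: eq_bigr => e _; rewrite mulrA.
rewrite (flow_test b' k j hb') -(flow_test b k j hb').
by apply: eq_bigr => e _; rewrite mulrAC mulrA.
Qed.

(** The difference y of the two harmonic coordinates is periodic. Testing both flow
    equations with y itself shows that its b'-energy is concentrated on e0, where
    it equals (b - b') s_k dy; as this energy is at least dy^2 / kappa, the value
    |dy| at e0 is at most kappa^2 |s_k|. *)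
Lemma cslope_one_edge k : `|cslope b' k e0| <= (1 + kappa ^+ 2) * `|cslope b k e0|.
Proof.
pose y t := chi_of b' t k 0 - chi_of b t k 0.
have hw e : cslope b' k e - cslope b k e = grad y e.
  by rewrite /cslope /slope /grad /y; ring.
have h1 : \sum_e b' e * grad y e ^+ 2 = (b e0 - b' e0) * (cslope b k e0 * grad y e0).
  rewrite -(sum_one_edge (fun e => cslope b k e * grad y e)).
  have -> : \sum_e b e * (cslope b k e * grad y e) = 0.
    by apply: etrans (flow_orthogonal k y hb); apply: eq_bigr => e _; rewrite mulrA.
  have o := flow_orthogonal k y hb'.
  rewrite -[LHS]subr0 -[X in _ - X = _]o -sumrB sub0r -sumrN.
  by apply: eq_bigr => e _; rewrite -hw; ring.
have h2 : kappa^-1 * grad y e0 ^+ 2 <= \sum_e b' e * grad y e ^+ 2.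
  rewrite (bigD1 e0)//= -[leLHS]addr0 lerD//.
    by rewrite ler_wpM2r ?sqr_ge0//; case/andP: (hb' e0).
  by apply: sumr_ge0 => e _; rewrite mulr_ge0 ?sqr_ge0// ltW// elliptic_gt0.
have h3 : `|grad y e0| <= kappa ^+ 2 * `|cslope b k e0|.
  have [->|w0] := eqVneq (grad y e0) 0; first by rewrite normr0 mulr_ge0 ?sqr_ge0.
  have h4 : kappa^-1 * grad y e0 ^+ 2 <= kappa * (`|cslope b k e0| * `|grad y e0|).
    apply: le_trans h2 _; rewrite h1; apply: le_trans (ler_norm _) _.
    by rewrite !normrM ler_wpM2r ?mulr_ge0// edge_diff_le.
  move: h4; rewrite ler_pdivrMl// -(real_normK (num_real (grad y e0))) expr2 !mulrA.
  by rewrite ler_pM2r ?normr_gt0// -expr2.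
rewrite mulrDl mul1r -[cslope b' k e0](subrK (cslope b k e0)) hw.
by apply: le_trans (ler_normD _ _) _; rewrite addrC lerD.
Qed.

(** The first term is the influence on the energy, the second the influence on
    the total conductance in the denominator. *)
Lemma tdiff_one_edge j k :
  `|tdiff b j k - tdiff b' j k| <=
  2 * kappa ^+ 4 / #|{: T * 'I_d}|%:R * (`|cslope b j e0| * `|cslope b k e0| + 1).
Proof.
set M := #|{: T * 'I_d}|%:R; have M0 : 0 < M :> R.
  by rewrite ltr0n; apply/card_gt0P; exists e0.
rewrite !tdiffE//; set B := \sum_e b e; set B' := \sum_e b' e.
have hB : kappa^-1 * M <= B by exact: conductance_sum_ge.
have hB' : kappa^-1 * M <= B' by exact: conductance_sum_ge.
have kM : 0 < kappa^-1 * M by rewrite mulr_gt0 ?invr_gt0.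
have B0 : 0 < B by exact: lt_le_trans hB.
have B0' : 0 < B' by exact: lt_le_trans hB'.
have iB : B^-1 <= kappa / M by rewrite -[leRHS]invrK invf_div mulrC lef_pV2 ?posrE.
have iB' : B'^-1 <= kappa / M by rewrite -[leRHS]invrK invf_div mulrC lef_pV2 ?posrE.
have hBB : B - B' = b e0 - b' e0.
  have := sum_one_edge (fun=> 1); rewrite mulr1 => <-.
  by congr (_ - _); apply: eq_bigr => e _; rewrite mulr1.
have -> : energy b j k / B - energy b' j k / B' =
    (energy b j k - energy b' j k) / B - energy b' j k * (B - B') / (B * B').
  by field; rewrite !gt_eqF.
rewrite hBB energy_one_edge; apply: le_trans (ler_normB _ _) _.
set x := `|cslope b j e0|; set z := `|cslope b k e0|.
have x0 : 0 <= x by exact: normr_ge0.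
have z0 : 0 <= z by exact: normr_ge0.
have t1 : `|(b e0 - b' e0) * (cslope b j e0 * cslope b' k e0) / B| <=
    kappa * (x * ((1 + kappa ^+ 2) * z)) * (kappa / M).
  rewrite !normrM (gtr0_norm (_ : 0 < B^-1)) ?invr_gt0//.
  apply: ler_pM; rewrite ?mulr_ge0 ?invr_ge0 ?(ltW B0)//.
  apply: ler_pM; rewrite ?mulr_ge0 ?edge_diff_le//.
  by rewrite ler_wpM2l ?cslope_one_edge.
have t2 : `|energy b' j k * (b e0 - b' e0) / (B * B')| <=
    kappa * M * kappa * (kappa / M * (kappa / M)).
  rewrite !normrM invfM (gtr0_norm (_ : 0 < B^-1 / B')) ?mulr_gt0 ?invr_gt0//.
  apply: ler_pM; rewrite ?mulr_ge0 ?invr_ge0 ?(ltW B0) ?(ltW B0')//.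
    by apply: ler_pM => //; [exact: energy_norm_le | exact: edge_diff_le].
  by apply: ler_pM; rewrite ?invr_ge0 ?(ltW B0) ?(ltW B0').
apply: le_trans (lerD t1 t2) _.
have -> : kappa * (x * ((1 + kappa ^+ 2) * z)) * (kappa / M) +
   kappa * M * kappa * (kappa / M * (kappa / M)) =
   ((kappa ^+ 2 + kappa ^+ 4) * (x * z) + kappa ^+ 4) / M.
  by field; rewrite gt_eqF.
rewrite mulrAC ler_wpM2r ?invr_ge0 ?(ltW M0)//.
have k24 : kappa ^+ 2 <= kappa ^+ 4 by rewrite ler_weXn2l.
have xz : 0 <= x * z by rewrite mulr_ge0.
have k4 : 0 <= kappa ^+ 4 by rewrite exprn_ge0// ltW.
nra.
Qed.

End OneEdge.

(** One factor s_j^2 of s_j^2 s_k^2 is bounded by G^2, and the sum of the other is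
    bounded by the energy estimate. *)
Lemma sum_influence b j k G : elliptic b -> (forall e, `|cslope b j e| <= G) ->
  \sum_e (2 * kappa ^+ 4 / #|{: T * 'I_d}|%:R *
     (`|cslope b j e| * `|cslope b k e| + 1)) ^+ 2 <=
  8 * kappa ^+ 10 * (G ^+ 2 + 1) / #|{: T * 'I_d}|%:R.
Proof.
move=> hb hG; set M := #|{: T * 'I_d}|%:R.
have M0 : 0 < M :> R.
  rewrite ltr0n; apply/card_gt0P; exists (0, Ordinal hd) => //.
have G0 : 0 <= G by apply: le_trans (hG (0, Ordinal hd)).
under eq_bigr do rewrite exprMn.
rewrite -mulr_sumr.
have h : \sum_e (`|cslope b j e| * `|cslope b k e| + 1) ^+ 2 <=
    2 * G ^+ 2 * (kappa ^+ 2 * M) + 2 * M.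
  apply: (@le_trans _ _ (\sum_e (2 * G ^+ 2 * cslope b k e ^+ 2 + 2))).
    apply: ler_sum => e _; set x := `|cslope b j e|; set z := `|cslope b k e|.
    have -> : cslope b k e ^+ 2 = z ^+ 2 by rewrite real_normK// num_real.
    have h1 : x * z <= G * z by apply: ler_wpM2r; [exact: normr_ge0 | exact: hG].
    have z0 : 0 <= z by exact: normr_ge0.
    have h2 : 0 <= x * z by rewrite mulr_ge0//; exact: normr_ge0.
    have h3 : (x * z) ^+ 2 <= G ^+ 2 * z ^+ 2.
      by rewrite -exprMn ler_sqr ?nnegrE// mulr_ge0.
    have := sqr_ge0 (x * z - 1); nra.
  rewrite big_split /= -mulr_sumr sumr_const -[2 *+ _]mulr_natr lerD2r.
  by rewrite ler_wpM2l ?mulr_ge0 ?sqr_ge0// sum_sqr_cslope.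
apply: le_trans (ler_wpM2l (sqr_ge0 _) h) _.
have k2 : 1 <= kappa ^+ 2 by rewrite exprn_ege1.
have -> : (2 * kappa ^+ 4 / M) ^+ 2 * (2 * G ^+ 2 * (kappa ^+ 2 * M) + 2 * M) =
   8 * kappa ^+ 8 * (G ^+ 2 * kappa ^+ 2 + 1) / M by field; rewrite gt_eqF.
rewrite ler_wpM2r ?invr_ge0 ?(ltW M0)//.
have k8 : 0 <= kappa ^+ 8 by rewrite exprn_ge0// ltW.
have -> : kappa ^+ 10 = kappa ^+ 8 * kappa ^+ 2 by rewrite -exprD.
rewrite -[leLHS]mulrA -[leRHS]mulrA -[X in _ <= _ * X]mulrA.
apply: ler_wpM2l => //; apply: (ler_wpM2l k8).
by rewrite mulrDr mulr1 [_ * kappa ^+ 2]mulrC lerD2l.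
Qed.

End Energy.

(** * Bounds on the gradient of the harmonic coordinates *)

Section Norm.
Variable d : nat.
Implicit Types x y : Zd d.

Lemma normoo_le x (m : nat) : (forall i, (absz (x i 0%R) <= m)%N) -> (normoo x <= m)%N.
Proof. by move=> h; apply/bigmax_leqP => i _. Qed.

Lemma le_normoo x i : (absz (x i 0%R) <= normoo x)%N.
Proof. exact: (leq_bigmax_cond (F := fun i => absz (x i 0%R))). Qed.

Lemma normoo0 : normoo (0 : Zd d) = 0%N.
Proof. by apply/eqP; rewrite -leqn0; apply: normoo_le => i; rewrite mxE. Qed.

Lemma normoo_unitv (i : 'I_d) : normoo (unitv i) = 1%N.
Proof.
apply/eqP; rewrite eqn_leq; apply/andP; split.
  by apply: normoo_le => j; rewrite mxE; case: (_ && _).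
by have := le_normoo (unitv i) i; rewrite mxE !eqxx.
Qed.

End Norm.

Section Harmonic.
Variables (R : realType) (d : nat).

Lemma cond_down (a : edge d -> R) x i : cond a x (x - unitv i) = a (x - unitv i, i).
Proof. by rewrite condC -{2}(subrK (unitv i) x) cond_edge. Qed.

Lemma powR_inv (x r : R) : 0 <= x -> (x^-1) `^ r = (x `^ r)^-1.
Proof. by move=> x0; rewrite -powR_inv1// -powRrM mulN1r powRN. Qed.

(** A coordinate function is harmonic for constant conductances. It has increment 1
    between neighbours and is at most 2 N on the box, so N^(alpha - 1) is bounded. *)
Lemma holder_exponent_le1 (kappa alpha : R) : (0 < d)%N -> 1 <= kappa ->
  holder_exponent d kappa alpha -> alpha <= 1.
Proof.
move=> hd hk [a0 [C' hC]]; rewrite leNgt; apply/negP => a1.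
pose i := Ordinal hd; pose u (x : Zd d) : R := (x i 0)%:~R.
have k0 : 0 < kappa by exact: lt_le_trans hk.
have ha (e : edge d) : kappa^-1 <= (1 : R) <= kappa by rewrite hk invf_le1 ?hk.
have hu x : \sum_(y <- nbrs x) cond (fun=> 1) x y * (u x - u y) = 0.
  rewrite sum_nbrs big1// => l _; rewrite cond_edge cond_down /u !mxE !mul1r.
  by rewrite intrD intrB; ring.
have hN N : (0 < N)%N -> N%:R `^ (alpha - 1) <= 2 * `|C'|.
  move=> N0; have N0' : 0 < N%:R :> R by rewrite ltr0n.
  have := hC (fun=> 1) ha N N0 0 u (fun x _ => hu x) (unitv i) 0.
  rewrite !subr0 normoo_unitv normoo0 => /(_ N0 isT).
  rewrite /u !mxE !eqxx subr0 normr1; set S := sup _.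
  have S0 : 0 <= S <= 2 * N%:R.
    have ub : ubound [set `|u w| | w in [set w | (normoo (w - 0)%R <= 2 * N)%N]] (2 * N%:R).
      move=> _ [w /= hw <-]; rewrite subr0 in hw.
      rewrite /u -intr_norm -abszE -natrM ler_nat; exact: leq_trans (le_normoo w i) hw.
    have mem0 : [set `|u w| | w in [set w | (normoo (w - 0)%R <= 2 * N)%N]] 0.
      by exists 0 => //=; [rewrite subr0 normoo0 | rewrite /u mxE normr0].
    apply/andP; split; last by apply: ge_sup => //; exists 0.
    by apply: ub_le_sup => //; exists (2 * N%:R).
  case/andP: S0 => S0 S1 h; have p0 : 0 <= (1 / N%:R : R) `^ alpha by exact: powR_ge0.
  have h1 : 1 <= `|C'| * (1 / N%:R) `^ alpha * (2 * N%:R).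
    apply: le_trans h _; apply: (@le_trans _ _ (`|C'| * (1 / N%:R) `^ alpha * S)).
      by rewrite ler_wpM2r// ler_wpM2r// ler_norm.
    by rewrite ler_wpM2l// mulr_ge0.
  rewrite powRB; last by rewrite (gt_eqF N0') implybT.
  rewrite powRr1 ?ler0n// ler_pdivrMr//.
  move: h1; rewrite div1r powR_inv ?ler0n// mulrAC ler_pdivlMr ?powR_gt0// mul1r.
  by rewrite mulrA [`|C'| * 2]mulrC.
pose K := 2 * `|C'| + 1.
have K0 : 0 <= K by rewrite /K addr_ge0// mulr_ge0.
have a1' : 0 < alpha - 1 by rewrite subr_gt0.
(* The side is chosen so large that N^(alpha - 1) exceeds the bound. *)
pose r := K `^ (alpha - 1)^-1.
have := hN (Num.bound r).+1 isT; apply/negP; rewrite -ltNge.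
apply: (@lt_le_trans _ _ K); first by rewrite /K ltrDl.
have -> : K = r `^ (alpha - 1).
  by rewrite /r -powRrM mulVf ?gt_eqF// powRr1.
apply: ge0_ler_powR; rewrite ?nnegrE ?powR_ge0 ?ler0n ?(ltW a1')//.
by apply: ltW; apply: lt_trans (archi_boundP _) _; rewrite ?powR_ge0 ?ltr_nat.
Qed.

(** The estimate is monotone in the supremum and in the constant, so an upper bound
    of |u| and a nonnegative constant may take their places. *)
Lemma holder_estimate (kappa alpha : R) : holder_exponent d kappa alpha ->
  exists2 K : R, 0 <= K &
  forall a : edge d -> R, (forall e, kappa^-1 <= a e <= kappa) ->
  forall N : nat, (0 < N)%N -> forall (z : Zd d) (u : Zd d -> R),
    (forall x, \sum_(y <- nbrs x) cond a x y * (u x - u y) = 0) ->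
  forall B : R, (forall w, (normoo (w - z)%R <= 2 * N)%N -> `|u w| <= B) ->
  forall x y, (normoo (x - z)%R <= N)%N -> (normoo (y - z)%R <= N)%N ->
    `|u x - u y| <= K * ((normoo (x - y)%R)%:R / N%:R) `^ alpha * B.
Proof.
move=> [_ [C' hC]]; exists `|C'| => // a ha N N0 z u hu B hB x y hx hy.
apply: le_trans (hC a ha N N0 z u (fun x _ => hu x) x y hx hy) _.
set S := sup _; set p := _ `^ alpha; have p0 : 0 <= p by exact: powR_ge0.
have ub : ubound [set `|u w| | w in [set w | (normoo (w - z)%R <= 2 * N)%N]] B.
  by move=> _ [w /= hw <-]; exact: hB.
have memz : [set `|u w| | w in [set w | (normoo (w - z)%R <= 2 * N)%N]] `|u z|.
  by exists z => //=; rewrite subrr normoo0.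
have S0 : 0 <= S.
  by apply: (@le_trans _ _ `|u z|) => //; apply: ub_le_sup => //; exists B.
have S1 : S <= B by apply: ge_sup => //; exists `|u z|.
apply: (@le_trans _ _ (`|C'| * p * S)).
  by rewrite ler_wpM2r// ler_wpM2r// ler_norm.
by rewrite ler_wpM2l// mulr_ge0.
Qed.

End Harmonic.

Section Gradient.
Variables (R : realType) (d : nat).

Definition lift_env n (b : tor d n * 'I_d -> R) (e : edge d) : R := b (red n e.1, e.2).

Lemma position_harmonic n (b : tor d n * 'I_d -> R) j c x :
  nondeg b != 0 ->
  \sum_(y <- nbrs x) cond (lift_env b) x y *
     ((position (chi_of b) x j 0 - c) - (position (chi_of b) y j 0 - c)) = 0.
Proof.
move=> hb; have [_ /(_ (red n x)) h] := chi_of_solves j hb.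
rewrite sum_nbrs -[RHS]oppr0 -[X in _ = - X]h -sumrN; apply: eq_bigr => i _.
rewrite cond_edge cond_down /lift_env /= redB -/(step n i).
have -> : position (chi_of b) x j 0 - c - (position (chi_of b) (x + unitv i) j 0 - c) =
  - slope (chi_of b) j (red n x, i) by rewrite -position_up; ring.
have -> : position (chi_of b) x j 0 - c - (position (chi_of b) (x - unitv i) j 0 - c) =
  slope (chi_of b) j (red n x - step n i, i).
  by rewrite -[RHS]opprK -position_down; ring.
ring.
Qed.

(** In a box of side L N around a vertex, v_j is of size at most 2 L N + O, where O
    is the oscillation of the corrector. For L large the regularity estimate
    shows that two vertices of one period have values within half of this size,
    which bounds O by a multiple of N. The estimate between neighbours then gains
    a factor (L N)^(- alpha). *)
Lemma corrector_slope_le (kappa alpha : R) : (0 < d)%N -> 1 <= kappa ->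
  holder_exponent d kappa alpha ->
  exists2 G0 : R, 0 <= G0 &
  forall n (b : tor d n * 'I_d -> R), elliptic kappa b ->
  forall j e, `|cslope b j e| <= G0 * n.+1%:R `^ (1 - alpha).
Proof.
move=> hd hk halpha; have a0 : 0 < alpha by case: halpha.
have [K K0 hK] := holder_estimate halpha.
pose r := (2 * K) `^ alpha^-1; pose L := (Num.bound r).+1.
have L0 : 0 < L%:R :> R by rewrite ltr0n.
have hL : K * L%:R^-1 `^ alpha <= 2^-1.
  rewrite powR_inv ?ler0n// ler_pdivrMr ?powR_gt0//.
  suff : 2 * K <= L%:R `^ alpha by lra.
  have -> : 2 * K = r `^ alpha.
    by rewrite /r -powRrM mulVf ?gt_eqF// powRr1// mulr_ge0.
  apply: ge0_ler_powR; rewrite ?nnegrE ?powR_ge0 ?ler0n ?(ltW a0)//.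
  by apply: ltW; apply: lt_trans (archi_boundP _) _; rewrite ?powR_ge0 ?ltr_nat.
(* O <= 2 (1 + L) N turns the size 2 L N + O of v_j into (4 L + 2) N. *)
exists (K * (4 * L%:R + 2)); first by rewrite mulr_ge0 ?addr_ge0 ?mulr_ge0.
move=> n b hb j e.
have b0 f : 0 < b f := elliptic_gt0 hk f hb.
have nd := elliptic_nondeg hd b0.
have ha (f : edge d) : kappa^-1 <= lift_env b f <= kappa by exact: hb.
pose chi t := chi_of b t j 0.
have [smax _ hmax] := @arg_maxP _ _ _ 0 xpredT chi isT.
have [smin _ hmin] := @arg_minP _ _ _ 0 xpredT chi isT.
pose O := chi smax - chi smin.
have hO s t : `|chi s - chi t| <= O.
  have := hmax s isT; have := hmax t isT; have := hmin s isT; have := hmin t isT.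
  rewrite /= => h1 h2 h3 h4; rewrite ler_norml /O; apply/andP; split; lra.
pose N := n.+1; pose M := (L * N)%N.
have N0 : 0 < N%:R :> R by rewrite ltr0n.
have M0 : (0 < M)%N by rewrite muln_gt0.
(* Subtracting the value at z bounds u by the size of the box. *)
pose u z x := position (chi_of b) x j 0 - position (chi_of b) z j 0.
have uE z x : u z x = (x j 0 - z j 0)%:~R + (chi (red n x) - chi (red n z)).
  by rewrite /u /position /chi !mxE intrB; ring.
have hu z w : (normoo (w - z)%R <= 2 * M)%N -> `|u z w| <= 2 * M%:R + O.
  move=> hw; rewrite uE; apply: le_trans (ler_normD _ _) _; apply: lerD => //.
  rewrite -intr_norm -abszE -natrM ler_nat; apply: leq_trans hw.
  by have := le_normoo (w - z) j; rewrite !mxE.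
have holder z x : (normoo (x - z)%R <= M)%N ->
    `|u z x| <= K * ((normoo (x - z)%R)%:R / M%:R) `^ alpha * (2 * M%:R + O).
  move=> hx; have := hK _ ha M M0 z (u z) _ _ (hu z) x z hx.
  rewrite subrr normoo0 => /(_ _ (leq0n _)); rewrite [u z z]subrr subr0; apply.
  by move=> w; exact: position_harmonic.
have O0 : 0 <= O by apply: le_trans (hO 0 0).
have B0 : 0 <= 2 * M%:R + O by rewrite addr_ge0// mulr_ge0.
have OB : O <= 2 * (1 + L%:R) * N%:R.
  pose x := rep smax; pose y := rep smin.
  have hxy : (normoo (x - y)%R <= N)%N.
    apply: normoo_le => i; rewrite !mxE.
    have /forallP/(_ i) : [forall i, 1 <= x i 0 <= N%:Z] by rewrite -mem_QN rep_QN.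
    have /forallP/(_ i) : [forall i, 1 <= y i 0 <= N%:Z] by rewrite -mem_QN rep_QN.
    rewrite /x /y !mxE; lia.
  have NM : (N <= M)%N by rewrite leq_pmull.
  have h1 := holder y x (leq_trans hxy NM).
  have h2 : K * ((normoo (x - y)%R)%:R / M%:R) `^ alpha <= 2^-1.
    apply: le_trans hL; rewrite ler_wpM2l//.
    apply: ge0_ler_powR; rewrite ?nnegrE ?divr_ge0 ?invr_ge0 ?ler0n ?(ltW a0)//.
    rewrite /M natrM invfM mulrCA ler_piMr ?invr_ge0 ?ler0n//.
    by rewrite ler_pdivrMr// mul1r ler_nat.
  have h3 : `|u y x| <= 2^-1 * (2 * M%:R + O).
    by apply: le_trans h1 _; rewrite ler_wpM2r.
  have h4 : O - N%:R <= `|u y x|.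
    rewrite uE /x /y !rep_red -/O; apply: le_trans (ler_norm _).
    rewrite addrC lerD2r lerNl -intrN (_ : N%:R = N%:Z%:~R)// ler_int.
    have := le_normoo (x - y) j; rewrite !mxE /x /y; move: hxy; rewrite -/x -/y; lia.
  move: h3 h4; rewrite /M natrM; lra.
case: e => t i; pose x := rep t.
have -> : cslope b j (t, i) = u x (x + unitv i).
  by rewrite /u position_up /x rep_red.
have h1 : (normoo (x + unitv i - x)%R = 1)%N by rewrite addrC addKr normoo_unitv.
have := holder x (x + unitv i); rewrite h1 => /(_ M0) h; apply: le_trans h _.
have h2 : (1%:R / M%:R : R) `^ alpha <= N%:R `^ (- alpha).
  rewrite powRN -powR_inv ?ler0n//.
  apply: ge0_ler_powR; rewrite ?nnegrE ?divr_ge0 ?invr_ge0 ?ler0n ?(ltW a0)//.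
  rewrite div1r lef_pV2 ?posrE ?ltr0n// ler_nat leq_pmull//.
have h3 : 2 * M%:R + O <= (4 * L%:R + 2) * N%:R by rewrite /M natrM; lra.
rewrite powRB ?(gt_eqF N0) ?implybT// powRr1 ?ler0n// -mulrA -[leRHS]mulrA ler_wpM2l//.
rewrite mulrA mulrC -powRN; apply: ler_pM => //; exact: powR_ge0.
Qed.

End Gradient.

Section OneDimensional.
Variables (R : realType) (n : nat) (kappa : R).
Hypothesis hkappa : 1 <= kappa.

(** On a cycle a divergence-free flow is a constant f, whose energy is the sum of
    f^2 / b(e); comparison with the energy bound gives |f| <= kappa. *)
Lemma corrector_slope_le_dim1 (b : tor 1 n * 'I_1 -> R) : elliptic kappa b ->
  forall j e, `|cslope b j e| <= kappa ^+ 2.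
Proof.
move=> hb j [t i]; have k0 : 0 < kappa by exact: lt_le_trans hkappa.
have b0 f : 0 < b f := elliptic_gt0 hkappa f hb.
have [_ hdiv] := chi_of_solves j (elliptic_nondeg (ltnSn 0) b0).
pose f s := b (s, ord0) * cslope b j (s, ord0).
have fc : forall s s', f s = f s'.
  apply: grad_eq0 => -[s l]; rewrite (ord1 l).
  have := hdiv (s + step n ord0); rewrite /div big_ord1 addrK.
  by rewrite /grad /f /= => h; rewrite -[RHS]h.
have E : \sum_(e : tor 1 n * 'I_1) kappa^-1 * f t ^+ 2 <= energy b j j.
  apply: ler_sum => -[s l] _; rewrite (ord1 l) (fc t s) /f exprMn.
  have /andP[h1 h2] := hb (s, ord0).
  rewrite -expr2 mulrA ler_wpM2r ?sqr_ge0// expr2 mulrA ler_piMl ?(ltW (b0 _))//.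
  by rewrite mulrC ler_pdivrMr// mul1r.
have := le_trans E (energy_le (ltnSn 0) hkappa j hb).
have card0 : 0 < #|{: tor 1 n * 'I_1}|%:R :> R.
  by rewrite ltr0n; apply/card_gt0P; exists (t, i).
rewrite sumr_const -[_ *+ _]mulr_natr ler_pM2r// ler_pdivrMl// -expr2.
rewrite -[X in X <= _]real_normK ?num_real// ler_sqr ?nnegrE ?(ltW k0)// => hf.
rewrite (ord1 i); have -> : cslope b j (t, ord0) = (b (t, ord0))^-1 * f t.
  by rewrite /f mulKf// gt_eqF.
rewrite normrM expr2 gtr0_norm ?invr_gt0//; apply: ler_pM => //; first by rewrite invr_ge0 ltW.
by rewrite -[leRHS]invrK lef_pV2 ?posrE ?invr_gt0//; case/andP: (hb (t, ord0)).
Qed.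

End OneDimensional.

(** * Measurability and the total influence *)

Section Measurability.
Context (disp : measure_display) (Om : measurableType disp) (R : realType).

(** For x > 0 the inverse is exp (- ln x); the value at 0 is 0. *)
Lemma measurable_inv (f : Om -> R) : measurable_fun setT f ->
  measurable_fun setT (fun w => (f w)^-1).
Proof.
move=> mf.
have -> : (fun w => (f w)^-1) = (fun w => if f w == 0 then 0 else
    if 0 < f w then expR (- ln (f w)) else - expR (- ln (- f w))).
  apply/funext => w; case: eqP => [->|/eqP f0]; first by rewrite invr0.
  case: ltP => hf; first by rewrite expRN lnK.
  have hf' : 0 < - f w by rewrite oppr_gt0 lt_neqAle f0.
  by rewrite expRN lnK ?posrE// invrN opprK.
have mN : measurable_fun setT (fun w => - f w) by exact: measurableT_comp.
have mln (g : Om -> R) : measurable_fun setT g -> measurable_fun setT (fun w => expR (- ln (g w))).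
  move=> mg; apply: measurableT_comp => //; apply: measurableT_comp => //.
  by apply: (measurableT_comp _ mg); exact: measurable_ln.
apply: measurable_fun_ifT; first exact: measurable_fun_eqr.
  exact: measurable_cst.
apply: measurable_fun_ifT; first exact: measurable_fun_ltr.
  exact: mln.
by apply: measurableT_comp => //; exact: mln.
Qed.

Lemma measurable_det m (A : Om -> 'M[R]_m) :
  (forall i j, measurable_fun setT (fun w => A w i j)) ->
  measurable_fun setT (fun w => \det (A w)).
Proof.
move=> mA; apply: measurable_sum => s; apply: measurable_funM; first exact: measurable_cst.
by apply: measurable_prod => i _.
Qed.

Lemma measurable_adj m (A : Om -> 'M[R]_m) i j :
  (forall i j, measurable_fun setT (fun w => A w i j)) ->
  measurable_fun setT (fun w => (\adj (A w)) i j).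
Proof.
move=> mA; under eq_fun do rewrite mxE.
apply: measurable_funM; first exact: measurable_cst.
by apply: measurable_det => k l; under eq_fun do rewrite !mxE; exact: mA.
Qed.

Variables (d n : nat) (b : Om -> tor d n * 'I_d -> R).
Hypothesis mb : forall e, measurable_fun setT (fun w => b w e).

Lemma measurable_tmass t : measurable_fun setT (fun w => tmass (b w) t).
Proof. by apply: measurable_sum => i; exact: measurable_funD. Qed.

Lemma measurable_kmx p q : measurable_fun setT (fun w => kmx (b w) p q).
Proof.
under eq_fun do rewrite mxE.
apply: measurable_funD; last exact: measurable_tmass.
apply: measurableT_comp => //; apply: measurable_sum => i.
by apply: measurable_funB; apply: measurable_funM => //; exact: measurable_cst.
Qed.

Lemma measurable_chi_of t j : measurable_fun setT (fun w => chi_of (b w) t j 0).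
Proof.
under eq_fun do rewrite mxE.
have mD : measurable_fun setT (fun w => \det (kmx (b w))).
  by apply: measurable_det => p q; exact: measurable_kmx.
apply: measurable_fun_ifT.
- apply: measurable_fun_eqr; last exact: measurable_cst.
  apply: measurable_funM => //; apply: measurable_prod => s _; exact: measurable_tmass.
- exact: measurable_cst.
- apply: measurable_sum => p; apply: measurable_funM.
    exact: measurable_funB.
  apply: measurable_funM; first exact: measurable_inv.
  by apply: measurable_adj => ? ?; exact: measurable_kmx.
Qed.

Lemma measurable_slope j e : measurable_fun setT (fun w => slope (chi_of (b w)) j e).
Proof.
apply: measurable_funD; first exact: measurable_cst.
by apply: measurable_funB; exact: measurable_chi_of.
Qed.

Lemma measurable_tdiff j k : measurable_fun setT (fun w => tdiff (b w) j k).
Proof.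
have ms := measurable_slope; have mt := measurable_tmass.
apply: measurable_sum => t; apply: measurable_funM.
  apply: measurable_funM => //; apply: measurable_inv.
  exact: measurable_sum.
apply: measurable_sum => i; apply: measurable_funD.
  apply: measurable_funM; last exact: measurable_funM.
  by apply: measurable_funM => //; apply: measurable_inv.
apply: measurable_funM; last exact: measurable_funM.
by apply: measurable_funM => //; apply: measurable_inv.
Qed.

End Measurability.

Lemma corrector_slope_one (R : realType) (d n : nat) (kappa : R) (b : tor d n * 'I_d -> R) j e :
  d = 1%N -> 1 <= kappa -> elliptic kappa b -> `|cslope b j e| <= kappa ^+ 2.
Proof. by move=> d1; subst d => hk hb; exact: corrector_slope_le_dim1. Qed.

Section InfluenceBound.
Variables (R : realType) (d : nat) (kappa alpha : R).
Hypotheses (hd : (0 < d)%N) (hkappa : 1 <= kappa).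
Hypothesis halpha : holder_exponent d kappa alpha.

Lemma card_edges n : #|{: tor d n * 'I_d}| = (n.+1 ^ d * d)%N.
Proof. by rewrite card_prod card_mx !card_ord muln1. Qed.

(** With slopes of order N^s the squared influences add up to order N^(2 s - d). In
    dimension at least 2 take s = 1 - alpha; then d - 2 + 2 alpha is at least alpha
    and at least d - 4 + alpha. In dimension one take s = 0 and use alpha <= 1. *)
Lemma influence_bound :
  exists2 V0 : R, 0 < V0 & forall n (b : tor d n * 'I_d -> R) j k, elliptic kappa b ->
  \sum_e (2 * kappa ^+ 4 / #|{: tor d n * 'I_d}|%:R *
     (`|cslope b j e| * `|cslope b k e| + 1)) ^+ 2 <=
  V0 * n.+1%:R `^ (- (2 * nu d alpha)).
Proof.
have k0 : 0 < kappa by exact: lt_le_trans hkappa.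
have a1 := holder_exponent_le1 hd hkappa halpha.
have a0 : 0 < alpha by case: halpha.
have c0 : 0 < 8 * kappa ^+ 10 by rewrite mulr_gt0// exprn_gt0.
have nuE : 2 * nu d alpha = Num.max alpha (d%:R - 4 + alpha) by rewrite /nu; field.
have cardM n : n.+1%:R ^+ d <= #|{: tor d n * 'I_d}|%:R :> R.
  by rewrite card_edges -natrX ler_nat leq_pmulr.
have main (G0 s : R) : 0 <= G0 -> 0 <= s -> 2 * s - d%:R <= - (2 * nu d alpha) ->
    (forall n (b : tor d n * 'I_d -> R) j e, elliptic kappa b ->
       `|cslope b j e| <= G0 * n.+1%:R `^ s) ->
    exists2 V0 : R, 0 < V0 & forall n (b : tor d n * 'I_d -> R) j k, elliptic kappa b ->
    \sum_e (2 * kappa ^+ 4 / #|{: tor d n * 'I_d}|%:R *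
     (`|cslope b j e| * `|cslope b k e| + 1)) ^+ 2 <=
    V0 * n.+1%:R `^ (- (2 * nu d alpha)).
  move=> G00 s0 hs hG; exists (8 * kappa ^+ 10 * (G0 ^+ 2 + 1)).
    by rewrite mulr_gt0// ltr_wpDl// sqr_ge0.
  move=> n b j k hb; apply: le_trans (sum_influence hd hkappa k hb (hG n b j ^~ hb)) _.
  set N : R := n.+1%:R; have N1 : 1 <= N by rewrite ler1n.
  have N0 : 0 < N by exact: lt_le_trans N1.
  rewrite -!(mulrA (8 * kappa ^+ 10)) ler_wpM2l ?(ltW c0)//.
  apply: (@le_trans _ _ ((G0 ^+ 2 + 1) * N `^ (2 * s) / N `^ d%:R)); last first.
    rewrite -mulrA ler_wpM2l ?addr_ge0 ?sqr_ge0//.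
    by rewrite -powRN -powRD ?(gt_eqF N0) ?implybT// ler_powR.
  apply: ler_pM.
  - by rewrite addr_ge0 ?sqr_ge0.
  - by rewrite invr_ge0.
  - rewrite exprMn mulrDl mul1r -(powR_mulrn 2 (powR_ge0 N s)) -powRrM [s * _]mulrC lerD2l.
    by rewrite -[leLHS](powRr0 N) ler_powR// mulr_ge0.
  - rewrite lef_pV2 ?posrE ?powR_gt0//; last first.
      by apply: lt_le_trans (cardM n); rewrite exprn_gt0.
    by rewrite powR_mulrn ?(ltW N0)//; exact: cardM.
have [d1|d2] : d = 1%N \/ (2 <= d)%N by case: (d) hd => [//|[|m]] _; [left | right].
  apply: (main (kappa ^+ 2) 0); rewrite ?sqr_ge0//.
    rewrite nuE mulr0 sub0r lerN2 d1 ge_max a1/=; lra.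
  by move=> n b j e hb; rewrite powRr0 mulr1; exact: corrector_slope_one.
have [G0 G00 hG] := corrector_slope_le hd hkappa halpha.
apply: (main G0 (1 - alpha)) => //.
- by rewrite subr_ge0.
- have d2' : 2 <= d%:R :> R by rewrite ler_nat.
  by rewrite nuE -lerN2 opprK ge_max; apply/andP; split; lra.
- by move=> n b j e hb; exact: hG.
Qed.

End InfluenceBound.

(** * Concentration of the diffusion matrix *)

Section Edges.
Variables (R : realType) (d n : nat).

(** The edge of the lattice whose conductance is read by a given edge of the
    torus; injectivity makes the conductances of the torus independent. *)
Definition torus_edge (e : tor d n * 'I_d) : edge d :=
  ((perpair n.+1 (rep e.1) (rep e.1 + unitv e.2)).1, e.2).

Lemma envtE (a : edge d -> R) e : envt a e = a (torus_edge e).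
Proof.
rewrite /envt /pcond /torus_edge /perpair /= -addrAC.
exact: cond_edge.
Qed.

Definition edge_proj (f : edge d) : tor d n * 'I_d := (red n f.1, f.2).

Lemma torus_edgeK : cancel torus_edge edge_proj.
Proof.
by case=> t i; rewrite /edge_proj /torus_edge /perpair /= redB redMn subr0 rep_red.
Qed.

End Edges.

Section ClippedDiffusion.
Variables (R : realType) (d n : nat) (kappa : R).
Hypotheses (hd : (0 < d)%N) (hkappa : 1 <= kappa).
Notation E := (tor d n * 'I_d)%type.
Notation U := (#|{: E}|.-tuple R).

Definition edge_value (u : U) (e : E) : R := tnth u (enum_rank e).

(** Truncation makes the environment elliptic everywhere and not only almost
    surely, so that the functions on the space of tuples are bounded. *)
Definition clip (x : R) : R := Num.max kappa^-1 (Num.min kappa x).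

Lemma clip_id x : kappa^-1 <= x <= kappa -> clip x = x.
Proof. by move=> /andP[h1 h2]; rewrite /clip (min_idPr h2) (max_idPr h1). Qed.

Lemma clip_bound x : kappa^-1 <= clip x <= kappa.
Proof.
have k0 : 0 < kappa by exact: lt_le_trans hkappa.
rewrite /clip le_max lexx /= ge_max ge_min lexx andbT.
by apply: le_trans hkappa; rewrite invf_le1.
Qed.

Definition cdiff (j k : 'I_d) (u : U) : R := tdiff (fun e => clip (edge_value u e)) j k.

Lemma elliptic_clip u : elliptic kappa (fun e => clip (edge_value u e)).
Proof. by move=> e; exact: clip_bound. Qed.

Lemma bmeas_cdiff j k : bmeas (cdiff j k).
Proof.
have k0 : 0 < kappa by exact: lt_le_trans hkappa.
split.
  apply: measurable_tdiff => e; apply: measurable_maxr; first exact: measurable_cst.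
  apply: measurable_minr; first exact: measurable_cst.
  exact: measurable_tnth.
exists (kappa * kappa) => u; have hb := elliptic_clip u.
have M0 : 0 < #|{: E}|%:R :> R.
  by rewrite ltr0n; apply/card_gt0P; exists (0, Ordinal hd).
have kM : 0 < kappa^-1 * #|{: E}|%:R by rewrite mulr_gt0 ?invr_gt0.
have hB := conductance_sum_ge hb.
have B0 := lt_le_trans kM hB.
rewrite /cdiff (tdiffE hd hkappa)// normrM normfV (gtr0_norm B0) ler_pdivrMr//.
apply: le_trans (energy_norm_le hd hkappa j k hb) _.
rewrite -mulrA ler_wpM2l ?(ltW k0)//.
by rewrite -ler_pdivrMl.
Qed.

Lemma cdiff_influence j k p :
  \sum_i (cdiff j k p.1 - cdiff j k (resample i p)) ^+ 2 <=
  \sum_e (2 * kappa ^+ 4 / #|{: E}|%:R *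
     (`|cslope (fun e => clip (edge_value p.1 e)) j e| *
      `|cslope (fun e => clip (edge_value p.1 e)) k e| + 1)) ^+ 2.
Proof.
rewrite [leRHS](reindex _ (onW_bij _ (@enum_val_bij E))) /=.
apply: ler_sum => i _.
set x := _ - _; set y := (X in _ <= X ^+ 2); have xy : `|x| <= y.
  apply: (tdiff_one_edge hd hkappa); try exact: elliptic_clip.
  by move=> e he; rewrite /edge_value tnth_mix /= -(inj_eq enum_val_inj) enum_rankK (negbTE he).
rewrite -[leLHS]real_normK ?num_real// ler_sqr ?nnegrE//.
exact: le_trans xy.
Qed.

End ClippedDiffusion.

Section Law.
Context (disp : measure_display) (Om : measurableType disp) (R : realType).
Variables (P : probability Om R) (d n : nat) (a : edge d -> {RV P >-> R}).
Notation E := (tor d n * 'I_d)%type.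
Notation U := (#|{: E}|.-tuple R).

Definition sample (w : Om) : U := [tuple a (torus_edge (enum_val i)) w | i < #|{: E}|].

Lemma tnth_sample w i : tnth (sample w) i = a (torus_edge (enum_val i)) w.
Proof. by rewrite tnth_mktuple. Qed.

Lemma measurable_sample : measurable_fun setT sample.
Proof.
apply/measurable_fun_tnthP => i; rewrite /comp.
under eq_fun do rewrite tnth_sample.
exact: measurable_funPT.
Qed.

HB.instance Definition _ := isMeasurableFun.Build _ _ _ _ sample measurable_sample.

Definition law : probability U R := distribution P (sample : {RV P >-> U}).

Lemma law_independent : mutually_independent a -> independent_coordinates law.
Proof.
move=> indep B mB.
(* Edges outside the image of torus_edge never occur in the family s below. *)
pose B' (f : edge d) : set R := B (enum_rank (edge_proj n f)).
have [s [us hs]] : exists s : seq (edge d), uniq s /\ s = [seq torus_edge e | e <- enum {: E}].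
  exists [seq torus_edge e | e <- enum {: E}]; split => //.
  rewrite map_inj_uniq ?enum_uniq//; exact: (can_inj (@torus_edgeK d n)).
have := indep s B' us (fun f => mB _).
have -> : \bigcap_(i in [set` s]) a i @^-1` B' i =
    sample @^-1` [set u | forall i, B i (tnth u i)].
  apply/seteqP; split => w /= h.
    move=> i; rewrite tnth_sample.
    have := h (torus_edge (enum_val i)); rewrite /= hs map_f ?mem_enum// => /(_ isT).
    by rewrite /preimage /= /B' torus_edgeK enum_valK.
  move=> f; rewrite /= hs => /mapP[e _ ->]; rewrite /preimage /= /B' torus_edgeK.
  by have := h (enum_rank e); rewrite tnth_sample enum_rankK.
rewrite -[X in X = _ -> _]/(law _) => ->.
rewrite hs big_map big_enum /= (reindex _ (onW_bij _ (@enum_val_bij E))) /=.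
apply: eq_bigr => i _; rewrite -[RHS]/(P (sample @^-1` _)); congr (P _).
apply/seteqP; split => w /=; rewrite /preimage /= tnth_sample /B' torus_edgeK enum_valK//.
Qed.

End Law.

Section AlmostSure.
Context (disp : measure_display) (Om : measurableType disp) (R : realType).
Variable P : probability Om R.

Lemma ae_le_measure (A B : set Om) : measurable A -> measurable B ->
  {ae P, forall w, A w -> B w} -> (P A <= P B)%E.
Proof.
move=> mA mB [Z [mZ Z0 hZ]].
apply: (@le_trans _ _ (P (B `|` Z))).
  apply: le_measure; rewrite ?inE//; first exact: measurableU.
  move=> w Aw; have [Bw|nB] := pselect (B w); [by left | right].
  by apply: hZ => /= h; exact/nB/h.
apply: le_trans (measureU2 _ mB mZ) _.
by have -> : (P B + P Z = P B)%E by rewrite (Z0 : P Z = 0%E) adde0.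
Qed.

Context (disp' : measure_display) (U : measurableType disp').
Variable X : {RV P >-> U}.

Lemma integral_ae_transfer (f : Om -> R) (g : U -> R) :
  measurable_fun setT f -> bmeas g -> {ae P, forall w, f w = g (X w)} ->
  (\int[P]_w (f w)%:E)%E = (mean (distribution P X) g)%:E.
Proof.
move=> mf bg fg; have bgX : bmeas (fun w => g (X w)).
  by apply: bmeas_comp => //; exact: measurable_funPT.
transitivity (\int[P]_w (g (X w))%:E)%E.
  apply: ae_eq_integral => //.
  - exact/measurable_EFinP.
  - by apply/measurable_EFinP; case: bgX.
  - by apply: filterS fg => w /= -> _.
have igX := bmeas_integrable P bgX.
rewrite -(integral_distribution (f := fun u => (g u)%:E))//; last first.
  by apply/measurable_EFinP; case: bg.
by rewrite /mean /Rintegral fineK//; apply: integrable_fin_num => //; exact: bmeas_integrable.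
Qed.

End AlmostSure.

Section Main.
Variables (R : realType) (d : nat) (kappa alpha : R).
Hypotheses (hd : (0 < d)%N) (hkappa : 1 <= kappa).

Lemma diffusion_concentration (disp : measure_display) (Om : measurableType disp)
    (P : probability Om R) (a : edge d -> {RV P >-> R}) n (j k : 'I_d) (V : R) :
  mutually_independent a ->
  (forall e, {ae P, forall w, kappa^-1 <= a e w <= kappa}) ->
  (forall (b : tor d n * 'I_d -> R), elliptic kappa b ->
    \sum_e (2 * kappa ^+ 4 / #|{: tor d n * 'I_d}|%:R *
     (`|cslope b j e| * `|cslope b k e| + 1)) ^+ 2 <= V) ->
  let D w := diffusion n.+1 (fun e => a e w) j k in
  (forall l s, 0 <= l -> l ^+ 2 * V <= 1 ->
    (P [set w | s%:E <= `| (D w)%:E - 'E_P[D] |] <= (4 * expR (- (l * s)))%:E)%E) /\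
  ('V_P[D] <= (V / 2)%:E)%E.
Proof.
move=> indep hell hV D; pose E := (tor d n * 'I_d)%type.
pose F := @cdiff R d n kappa j k; pose X : {RV P >-> _} := sample n a.
have bF : bmeas F := bmeas_cdiff n hd hkappa j k.
have iX := law_independent (n := n) indep.
have hFV p : \sum_i (F p.1 - F (resample i p)) ^+ 2 <= V.
  by apply: le_trans (cdiff_influence hd hkappa j k p) _; apply: hV; exact: elliptic_clip.
have DE w : D w = tdiff (fun e : E => edge_value (X w) e) j k.
  rewrite /D diffusionE//; congr tdiff; apply/funext => e.
  by rewrite envtE /edge_value tnth_sample enum_rankK.
have mD : measurable_fun setT D.
  have -> : D = (fun w => tdiff (fun e : E => edge_value (X w) e) j k).
    by apply/funext => w; exact: DE.
  apply: measurable_tdiff => e.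
  under eq_fun do rewrite /edge_value tnth_sample.
  exact: measurable_funPT.
have Dae : {ae P, forall w, D w = F (X w)}.
  have : {ae P, forall w, forall e : E, kappa^-1 <= a (torus_edge e) w <= kappa}.
    by apply: filter_forall => e; exact: hell.
  apply: filterS => w hw; rewrite DE /F /cdiff; congr tdiff; apply/funext => e.
  by rewrite clip_id// /edge_value tnth_sample enum_rankK.
have ED : ('E_P[D] = (mean (law n a) F)%:E)%E.
  by rewrite unlock; exact: (integral_ae_transfer (X := X)).
have bm : bmeas (fun u => F u - mean (law n a) F) by apply: bmeasB => //; exact: bmeas_cst.
have mDm : measurable_fun setT (fun w => D w - mean (law n a) F).
  by apply: measurable_funB => //; exact: measurable_cst.
split=> [l s l0 hl|].
  have := exponential_tail iX s bF hFV l0 hl; set A' := [set u | _]; apply: le_trans.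
  have -> : [set w | (s%:E <= `|(D w)%:E - 'E_P[D]|)%E] =
      [set w | s <= `|D w - mean (law n a) F|].
    by apply/seteqP; split => w; rewrite /= ED -EFinB /= lee_fin.
  have level (dd : measure_display) (Y : measurableType dd) (h : Y -> R) :
      measurable_fun setT h -> measurable [set w | s <= `|h w|].
    move=> mh; rewrite -[X in measurable X]setTI.
    have mN : measurable_fun setT (fun u => `|h u|) by exact: measurableT_comp.
    have := measurable_fun_ler (measurable_cst s) mN.
    by move=> /(_ measurableT [set true] _); apply.
  rewrite -[leRHS]/(P (X @^-1` A')); apply: ae_le_measure.
  - exact: level.
  - rewrite -[X in measurable X]setTI; apply: (measurable_funPT X) => //.
    by apply: level; case: bm.
  - by apply: filterS Dae => w /= ->.
rewrite /variance [in leLHS]unlock ED /=.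
have -> : ('E_P[(D \- cst (mean (law n a) F)) * (D \- cst (mean (law n a) F))] =
    (mean (law n a) (fun u => (F u - mean (law n a) F) ^+ 2)%R)%:E)%E.
  rewrite unlock; apply: (integral_ae_transfer (X := X)).
  - exact: measurable_funM.
  - exact: bmeasX.
  - by apply: filterS Dae => w hw; rewrite /= -hw expr2.
rewrite lee_fin; apply: le_trans (variance_le iX bF hFV).
set c := mean (law n a) F.
rewrite (_ : (fun u => (F u - c) ^+ 2) = (fun u => (F u ^+ 2 - 2 * c * F u) + c ^+ 2)); last first.
  by apply/funext => u; ring.
have b1 : bmeas (fun u => F u ^+ 2) by exact: bmeasX.
have b2 : bmeas (fun u => 2 * c * F u) by apply: bmeasM => //; exact: bmeas_cst.
rewrite meanD ?mean_cst ?meanB ?meanZ//; [|exact: bmeasB|exact: bmeas_cst].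
by rewrite -/c le_eqVlt; apply/orP; left; apply/eqP; ring.
Qed.

End Main.

Theorem theorem1 (R : realType) (d : nat) (kappa alpha : R) (hd : (1 <= d)%N)
  (hkappa : 1 <= kappa) (halpha : holder_exponent d kappa alpha) :
  exists2 C : R, 0 < C &
  forall (disp : measure_display) (T : measurableType disp) (P : probability T R)
    (a : edge d -> {RV P >-> R}),
    iid a ->
    (forall e, {ae P, forall w, kappa^-1 <= a e w <= kappa}) ->
    let D (N : nat) (i j : 'I_d) (w : T) : R := diffusion N (fun e => a e w) i j in
    (forall (t : R) (N : nat), 0 < t -> (1 <= N)%N ->
      (\big[maxe/-oo]_(i < d) \big[maxe/-oo]_(j < d)
         P [set w | (t * N%:R `^ (- nu d alpha))%:E
                      <= `| (D N i j w)%:E - 'E_P[D N i j] |]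
       <= (4 * expR (- (C * t)))%:E)%E) /\
    (forall N : nat, (1 <= N)%N ->
      (\big[maxe/-oo]_(i < d) \big[maxe/-oo]_(j < d) 'V_P[D N i j]
       <= (8 * C ^- 2 * N%:R `^ (- (2 * nu d alpha)))%:E)%E).
Proof.
have [V0 V00 hV] := influence_bound hd hkappa halpha.
have max_le (c : \bar R) (f : 'I_d -> 'I_d -> \bar R) : (forall i j, (f i j <= c)%E) ->
    (\big[maxe/-oo]_(i < d) \big[maxe/-oo]_(j < d) f i j <= c)%E.
  move=> h; apply: (big_ind (fun x => (x <= c)%E)); first exact: leNye.
    by move=> x y hx hy; rewrite ge_max hx hy.
  move=> i _; apply: (big_ind (fun x => (x <= c)%E)); first exact: leNye.
    by move=> x y hx hy; rewrite ge_max hx hy.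
  by move=> j _.
(* With l = N^nu / sqrt V0 the condition l^2 V <= 1 is an equality, and
   l t N^(- nu) = t / sqrt V0. *)
exists (Num.sqrt V0)^-1; first by rewrite invr_gt0 sqrtr_gt0.
move=> disp T P a [indep _] hell D; split => [t [//|n] t0 _|[//|n] _]; apply: max_le => i j.
  have [h _] := diffusion_concentration hd hkappa indep hell (fun b hb => hV n b i j hb).
  set N : R := n.+1%:R; set nn := nu d alpha.
  have N0 : 0 < N by rewrite ltr0n.
  have p0 : 0 < N `^ nn by rewrite powR_gt0.
  have q0 : Num.sqrt V0 != 0 by rewrite gt_eqF// sqrtr_gt0.
  have l0 : 0 <= N `^ nn / Num.sqrt V0 by rewrite divr_ge0 ?sqrtr_ge0 ?powR_ge0.
  have hl : (N `^ nn / Num.sqrt V0) ^+ 2 * (V0 * N `^ (- (2 * nn))) <= 1.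
    have e2 : N `^ (2 * nn) = (N `^ nn) ^+ 2.
      by rewrite -(powR_mulrn 2 (powR_ge0 N nn)) -powRrM mulrC.
    rewrite expr_div_n sqr_sqrtr ?(ltW V00)// powRN e2.
    by rewrite le_eqVlt; apply/orP; left; apply/eqP; field; rewrite !gt_eqF.
  have hs : N `^ nn / Num.sqrt V0 * (t * N `^ (- nn)) = (Num.sqrt V0)^-1 * t.
    by rewrite powRN; field; rewrite q0 gt_eqF.
  by have := h _ (t * N `^ (- nn)) l0 hl; rewrite hs.
have [_ h] := diffusion_concentration hd hkappa indep hell (fun b hb => hV n b i j hb).
apply: le_trans h _; rewrite lee_fin exprVn invrK sqr_sqrtr ?(ltW V00)//.
have : 0 <= V0 * n.+1%:R `^ (- (2 * nu d alpha)) by rewrite mulr_ge0 ?powR_ge0 ?(ltW V00).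
move=> h0; rewrite -[leRHS]mulrA; lra.
Qed.
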